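(* Work in either the $C^*$-setting or the $W^*$-setting. Let $X=(X(n))_{n\in\mathbb{Z}_+}$ be a standard subproduct system, and let $T$ be a completely contractive, covariant representation of $X$. If $T$ is pure and relatively isometric, then it is (unitarily equivalent to) an induced representation, and it extends to a $C^*$-representation.
   Context: Conventions. Hilbert spaces are complex; $C^*$-algebras need not be unital; all representations of operator algebras on Hilbert spaces are assumed nondegenerate. $\mathcal{L}(F)$ denotes the adjointable operators on a Hilbert module $F$. Two settings are considered. $C^*$-setting: $\mathcal{M}$ is a $C^*$-algebra; a correspondence over $\mathcal{M}$ is a right Hilbert $C^*$-module $F$ over $\mathcal{M}$ (inner product $\langle\cdot,\cdot\rangle$ linear in the second variable) with a left action $a\zeta=\varphi(a)\zeta$ given by a $*$-homomorphism $\varphi:\mathcal{M}\to\mathcal{L}(F)$; tensor products are interior tensor products. $W^*$-setting: $\mathcal{M}$ is a von Neumann algebra, correspondences are required to be self-dual with $\varphi$ normal, and tensor products and direct sums of correspondences mean the self-dual completions of the usual ones. For a representation $\sigma$ of $\mathcal{M}$ on $\mathcal{H}$, $F\otimes_\sigma\mathcal{H}$ is the Hilbert space with $(\zeta_1\otimes h_1,\zeta_2\otimes h_2)=(h_1,\sigma(\langle\zeta_1,\zeta_2\rangle)h_2)$. Standard subproduct system: a family $X=(X(n))_{n\in\mathbb{Z}_+}$ of correspondences over $\mathcal{M}$ with $X(0)=\mathcal{M}$ such that $X(n+m)$ is an orthogonally complementable sub-bimodule of $X(n)\otimes X(m)$ for all $n,m$ (where $X(n)\otimes\mathcal{M}$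 and $\mathcal{M}\otimes X(n)$ are identified with $X(n)$ via the module actions, so the left actions are nondegenerate). Put $E=X(1)$; then $X(n)\subseteq E^{\otimes n}$ ($E^{\otimes 0}=\mathcal{M}$), and $p_n\in\mathcal{L}(E^{\otimes n})$ is the orthogonal projection onto $X(n)$. Completely contractive, covariant representation of $X$ on $\mathcal{H}$: a family $T=(T_n)_{n\in\mathbb{Z}_+}$ of linear maps $T_n:X(n)\to B(\mathcal{H})$ such that $\sigma:=T_0$ is a $C^*$-representation of $\mathcal{M}$ on $\mathcal{H}$; each $T_n$ is completely contractive (with $X(n)$ viewed inside its linking algebra); $T_n(\zeta a)=T_n(\zeta)\sigma(a)$ and $T_n(a\zeta)=\sigma(a)T_n(\zeta)$; and $T_{n+m}(p_{n+m}(\zeta\otimes\eta))=T_n(\zeta)T_m(\eta)$ for $\zeta\in X(n),\eta\in X(m)$. In the $W^*$-setting $\sigma$ is also required to be normal, and each $T_n$ continuous from the $\sigma$-topology of $X(n)$ (generated by the functionals $x\mapsto\sum_i\omega_i(\langle\eta_i,x\rangle)$ with $\omega_i\in\mathcal{M}_*$, $\eta_i\in X(n)$, $\sum_i\|\omega_i\|\|\eta_i\|<\infty$) to the ultraweak topology (this continuity is automatic when $\sigma$ is normal). For each $n$, $\widetilde{T}_n:X(n)\otimes_\sigma\mathcal{H}\to\mathcal{H}$ is the contraction $\widetilde{T}_n(\zeta\otimes h)=T_n(\zeta)h$. $T$ is pure if $\widetilde{T}_n\widetilde{T}_n^*\to 0$ in the strong operator topology. $\Delta_*:=(I_{\mathcal{H}}-\widetilde{T}_1\widetilde{T}_1^*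 )^{1/2}$, which commutes with $\sigma(\mathcal{M})$. $T$ is relatively isometric if all the maps $\widetilde{T}_n$, $n\in\mathbb{Z}_+$, are partial isometries and one (equivalently, both) of the following conditions holds: (a) $X(n)\otimes_\sigma\operatorname{Im}\Delta_*\subseteq\operatorname{Im}\widetilde{T}_n^*$ for all $n\in\mathbb{Z}_+$; (b) $\Delta_*T_n(\zeta)^*T_n(\zeta)\Delta_*=\sigma(\langle\zeta,\zeta\rangle)\Delta_*$ for all $n\in\mathbb{Z}_+$, $\zeta\in X(n)$. $X$-Fock space and shift: $\mathcal{F}_X=\bigoplus_{n\in\mathbb{Z}_+}X(n)$, and for $\zeta\in X(n)$, $S_n(\zeta)\in\mathcal{L}(\mathcal{F}_X)$ is given by $S_n(\zeta)\eta=p_{n+m}(\zeta\otimes\eta)$ for $\eta\in X(m)$. The Toeplitz algebra $\mathcal{T}(X)$ is the $C^*$-subalgebra of $\mathcal{L}(\mathcal{F}_X)$ generated by all $S_n(\zeta)$, $n\in\mathbb{Z}_+$, $\zeta\in X(n)$. Induced representation: given a $C^*$-representation $\pi$ of $\mathcal{M}$ on a Hilbert space $\mathcal{D}$ (normal in the $W^*$-setting), the covariant representation induced by $\pi$ is the family $(S_n(\cdot)\otimes I_{\mathcal{D}})_{n\in\mathbb{Z}_+}$ on $\mathcal{F}_X\otimes_\pi\mathcal{D}$. $T$ (on $\mathcal{H}$) extends to a $C^*$-representation if there is a $C^*$-representation $\pi$ of $\mathcal{T}(X)$ on $\mathcal{H}$ with $\pi(S_n(\zeta))=T_n(\zeta)$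 for all $n\in\mathbb{Z}_+$, $\zeta\in X(n)$. *)

(* Defs.v *)
From HB Require Import structures.
From mathcomp Require Import all_boot all_order all_algebra.
From mathcomp Require Import complex.
From mathcomp Require Import all_classical all_reals all_analysis.

Set Implicit Arguments.
Unset Strict Implicit.
Unset Printing Implicit Defensive.

Import Order.TTheory GRing.Theory Num.Theory.
Import numFieldNormedType.Exports.

Local Open Scope classical_set_scope.
Local Open Scope ring_scope.

(* Scalars are R[i] for a realType R; norms take their values in R[i].
   All inner products are linear in the second variable.

   Interior tensor products, direct sums and X-Fock spaces are not constructed.
   They are taken as models: a module with the structural map(s), the prescribed
   inner product and the appropriate density. Models are unique up to a unique
   isomorphism compatible with the structural maps. *)

Section OperatorAlgebras.
Variable R : realType.
Local Notation C := R[i].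

Record hilbert := Hilbert {
  hcar :> completeNormedModType C;
  hip : hcar -> hcar -> C;
  hip_linear : forall x c y z, hip x (c *: y + z) = c * hip x y + hip x z;
  hip_conj : forall x y, hip y x = Num.conj (hip x y);
  hip_norm : forall x, `|x| ^+ 2 = hip x x
}.

Definition span (V : lmodType C) (S : set V) : set V :=
  [set x | exists (n : nat) (c : 'I_n -> C) (v : 'I_n -> V),
     (forall i, S (v i)) /\ x = \sum_(i < n) c i *: v i].

Definition bounded_op (V W : normedModType C) (f : V -> W) : Prop :=
  linear f /\ exists c : C, forall x, `|f x| <= c * `|x|.

(* The operator adjoint, chosen classically: Riesz' theorem provides it for
   every bounded operator, and it is unique. *)
Definition adj (H K : hilbert) (A : H -> K) : K -> H :=
  xget (0 : K -> H)
    [set B : K -> H | bounded_op B /\ forall x y, hip (A x) y = hip x (B y)].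

(* The positive square root, chosen classically: a positive bounded operator
   has exactly one. *)
Definition psqrt (H : hilbert) (A : H -> H) : H -> H :=
  xget (0 : H -> H)
    [set B : H -> H | [/\ bounded_op B, forall x, 0 <= hip x (B x)
                        & forall x, B (B x) = A x]].

Definition partial_isometry (H K : hilbert) (A : H -> K) : Prop :=
  bounded_op A /\
  forall x, (forall y, A y = 0 -> hip y x = 0) -> `|A x| = `|x|.

Definition unitary (H K : hilbert) (U : H -> K) : Prop :=
  [/\ linear U, forall x y, hip (U x) (U y) = hip x y
    & forall k, exists h, U h = k].

(* Not necessarily unital. *)
Record cstar_algebra := CstarAlgebra {
  acar :> completeNormedModType C;
  amul : acar -> acar -> acar;
  astar : acar -> acar;
  amulA : forall a b c, amul a (amul b c) = amul (amul a b) c;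
  amul_linearr : forall a (k : C) b c,
    amul a (k *: b + c) = k *: amul a b + amul a c;
  amul_linearl : forall a (k : C) b c,
    amul (k *: b + c) a = k *: amul b a + amul c a;
  astarK : forall a, astar (astar a) = a;
  astarM : forall a b, astar (amul a b) = amul (astar b) (astar a);
  astar_semilinear : forall (k : C) a b,
    astar (k *: a + b) = Num.conj k *: astar a + astar b;
  amul_norm : forall a b, `|amul a b| <= `|a| * `|b|;
  astar_norm : forall a, `|amul (astar a) a| = `|a| ^+ 2
}.

Record cstar_rep (M : cstar_algebra) (H : hilbert) (pi : M -> H -> H) : Prop :=
  CstarRep {
  rep_bounded : forall a, bounded_op (pi a);
  rep_linear : forall (c : C) a b h, pi (c *: a + b) h = c *: pi a h + pi b h;
  rep_mul : forall a b h, pi (amul a b) h = pi a (pi b h);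
  rep_star : forall a h k, hip (pi a h) k = hip h (pi (astar a) k);
  rep_nondegenerate :
    closure (span [set x | exists a h, x = pi a h]) = setT
}.

(* A functional on B(H) that is continuous for the ultraweak topology. *)
Definition ultraweak_functional (H : hilbert) (g : (H -> H) -> C) : Prop :=
  exists x y : nat -> H,
  [/\ cvgn (series (fun n => `|x n| ^+ 2 : C^o)),
      cvgn (series (fun n => `|y n| ^+ 2 : C^o))
    & forall A, bounded_op A ->
        series (fun n => hip (x n) (A (y n)) : C^o) @ \oo --> (g A : C^o)].

Definition commutant (H : hilbert) (S : set (H -> H)) : set (H -> H) :=
  [set B | bounded_op B /\ forall A, S A -> forall h, A (B h) = B (A h)].

(* M is a von Neumann algebra: it is identified by [vrep] with a nondegenerate
   *-algebra of operators equal to its bicommutant. *)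
Record von_neumann (M : cstar_algebra) := VonNeumann {
  vspace : hilbert;
  vrep : M -> vspace -> vspace;
  vrep_rep : cstar_rep vrep;
  vrep_inj : injective vrep;
  vrep_bicommutant : commutant (commutant (range vrep)) = range vrep
}.

(* The elements of the predual of M. *)
Definition normal_functional (M : cstar_algebra) (V : von_neumann M)
    (w : M -> C) : Prop :=
  exists g : (vspace V -> vspace V) -> C,
    ultraweak_functional g /\ forall a, w a = g (vrep a).

Variant setting (M : cstar_algebra) : Type :=
  | Cstar_setting
  | Wstar_setting of von_neumann M.
Arguments Cstar_setting {M}.

Section Modules.
Variable M : cstar_algebra.

(* A right Hilbert C*-module over M with a left action of M by adjointable
   operators. *)
Record correspondence := Correspondence {
  ccar :> completeNormedModType C;
  ract : ccar -> M -> ccar;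
  cip : ccar -> ccar -> M;
  lact : M -> ccar -> ccar;
  ract_linearl : forall a (c : C) x y,
    ract (c *: x + y) a = c *: ract x a + ract y a;
  ract_linearr : forall x (c : C) a b,
    ract x (c *: a + b) = c *: ract x a + ract x b;
  ractM : forall x a b, ract x (amul a b) = ract (ract x a) b;
  cip_linear : forall x (c : C) y z,
    cip x (c *: y + z) = c *: cip x y + cip x z;
  cip_ract : forall x y a, cip x (ract y a) = amul (cip x y) a;
  cip_star : forall x y, cip y x = astar (cip x y);
  cip_ge0 : forall x, exists b, cip x x = amul (astar b) b;
  cip_norm : forall x, `|x| ^+ 2 = `|cip x x|;
  lact_linearl : forall x (c : C) a b,
    lact (c *: a + b) x = c *: lact a x + lact b x;
  lact_linearr : forall a (c : C) x y,
    lact a (c *: x + y) = c *: lact a x + lact a y;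
  lactM : forall a b x, lact (amul a b) x = lact a (lact b x);
  lact_star : forall a x y, cip (lact a x) y = cip x (lact (astar a) y)
}.

Lemma self_ip_star (x y : M) : amul (astar y) x = astar (amul (astar x) y).
Proof. by rewrite astarM astarK. Qed.

Lemma self_ip_ge0 (x : M) :
  exists b : M, amul (astar x) x = amul (astar b) b.
Proof. by exists x. Qed.

Lemma self_lact_star (a x y : M) :
  amul (astar (amul a x)) y = amul (astar x) (amul (astar a) y).
Proof. by rewrite astarM amulA. Qed.

(* M as a correspondence over itself, with inner product a^* b. *)
Definition self_corr : correspondence :=
  @Correspondence M (@amul M) (fun x y => amul (astar x) y) (@amul M)
    (@amul_linearl M) (@amul_linearr M) (@amulA M)
    (fun x => @amul_linearr M (astar x))
    (fun x y a => @amulA M (astar x) y a)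
    self_ip_star self_ip_ge0 (fun x => esym (@astar_norm M x))
    (@amul_linearl M) (@amul_linearr M)
    (fun a b x => esym (@amulA M a b x)) self_lact_star.

Definition is_cadjoint (F : correspondence) (A B : F -> F) : Prop :=
  forall x y, cip (A x) y = cip x (B y).

(* Membership in the C*-algebra L(F). *)
Definition adjointable (F : correspondence) (A : F -> F) : Prop :=
  exists B : F -> F, is_cadjoint A B.

Definition self_dual (F : correspondence) : Prop :=
  forall f : F -> M,
    bounded_op f -> (forall x a, f (ract x a) = amul (f x) a) ->
    exists y : F, forall x, f x = cip y x.

(* The functionals x |-> \sum_i w_i <eta_i, x>, with w_i in the predual and
   \sum_i |w_i| |eta_i| finite; c_i bounds the norm of w_i. *)
Definition sigma_functional (V : von_neumann M) (F : correspondence)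
    (f : F -> C) : Prop :=
  exists (w : nat -> M -> C) (eta : nat -> F) (c : nat -> C),
  [/\ forall i, normal_functional V (w i),
      forall i a, `|w i a| <= c i * `|a|,
      forall i, 0 <= c i,
      cvgn (series (fun i => c i * `|eta i| : C^o))
    & forall x,
        series (fun i => w i (cip (eta i) x) : C^o) @ \oo --> (f x : C^o)].

Definition sigma_closure (V : von_neumann M) (F : correspondence)
    (S : set F) : set F :=
  [set x | forall (m : nat) (f : 'I_m -> F -> C) (e : C),
     (forall i, sigma_functional V (f i)) -> 0 < e ->
     exists2 y, S y & forall i, `|f i y - f i x| < e].

(* Continuity of T : F -> B(H) from the sigma-topology to the ultraweak one. *)
Definition sigma_continuous (V : von_neumann M) (F : correspondence)
    (H : hilbert) (T : F -> H -> H) : Prop :=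
  forall (x0 : F) (g : (H -> H) -> C) (e : C),
    ultraweak_functional g -> 0 < e ->
    exists (m : nat) (f : 'I_m -> F -> C) (d : C),
    [/\ forall i, sigma_functional V (f i), 0 < d
      & forall x, (forall i, `|f i x - f i x0| < d) ->
                  `|g (T x) - g (T x0)| < e].

(* Normality of the left action M -> L(F): L(F) (F self-dual) is a W*-algebra
   whose predual is the closed span of the functionals A |-> w <x, A y>. *)
Definition normal_left_action (V : von_neumann M) (F : correspondence) : Prop :=
  forall (x y : F) (w : M -> C), normal_functional V w ->
    normal_functional V (fun a => w (cip x (lact a y))).

Variable s : setting M.

Definition admissible (F : correspondence) : Prop :=
  match s with
  | Cstar_setting => True
  | Wstar_setting V => self_dual F /\ normal_left_action V F
  end.

(* The completion of the linear span of S inside F. In the W*-setting, the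
   self-dual completion of a submodule of a self-dual module is its closure in
   the sigma-topology. *)
Definition completion (F : correspondence) (S : set F) : set F :=
  match s with
  | Cstar_setting => closure (span S)
  | Wstar_setting V => sigma_closure V (span S)
  end.

Definition normal_rep (H : hilbert) (pi : M -> H -> H) : Prop :=
  match s with
  | Cstar_setting => True
  | Wstar_setting V => forall h k, normal_functional V (fun a => hip h (pi a k))
  end.

Definition representation (H : hilbert) (pi : M -> H -> H) : Prop :=
  cstar_rep pi /\ normal_rep pi.

(* (G, t) is a model of the tensor product of the correspondences F1 and F2:
   the interior one, or its self-dual completion in the W*-setting. *)
Record is_tensor (F1 F2 G : correspondence) (t : F1 -> F2 -> G) : Prop :=
  IsTensor {
  tens_admissible : admissible G;
  tens_linearl : forall y, linear (fun x => t x y);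
  tens_linearr : forall x, linear (t x);
  tens_balanced : forall x a y, t (ract x a) y = t x (lact a y);
  tens_ip : forall x y x' y',
    cip (t x y) (t x' y') = cip y (lact (cip x x') y');
  tens_lact : forall a x y, lact a (t x y) = t (lact a x) y;
  tens_ract : forall x y a, ract (t x y) a = t x (ract y a);
  tens_dense : completion [set z | exists x y, z = t x y] = setT
}.

Record bimodule_isometry (F G : correspondence) (i : F -> G) : Prop :=
  BimoduleIsometry {
  bi_linear : linear i;
  bi_ract : forall x a, i (ract x a) = ract (i x) a;
  bi_lact : forall a x, i (lact a x) = lact a (i x);
  bi_ip : forall x y, cip (i x) (i y) = cip x y
}.

(* A graded family whose term of degree 0 is M itself. *)
Definition graded (F : nat -> correspondence) (n : nat) : correspondence :=
  if n is k.+1 then F k else self_corr.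

(* [sp_power] are the tensor powers of E = X(1), and [sp_incl] is the inclusion
   of X(n) in E^{\otimes n}. The equalities in [sp_tensA] and [sp_tens1] are
   between elements of E^{\otimes k} for two provably equal values of k. *)
Record subproduct_system := SubproductSystem {
  sp_fibre_pos : nat -> correspondence;
  sp_power_pos : nat -> correspondence;
  sp_fibre := graded sp_fibre_pos;
  sp_power := graded sp_power_pos;
  sp_tens : forall n m, sp_power n -> sp_power m -> sp_power (n + m)%N;
  sp_incl : forall n, sp_fibre n -> sp_power n;
  sp_fibre_admissible : forall n, admissible (sp_fibre n);
  sp_power_admissible : forall n, admissible (sp_power n);
  sp_tens_tensor : forall n m, is_tensor (@sp_tens n m);
  sp_tensA : forall n m k (x : sp_power n) (y : sp_power m) (z : sp_power k),
    existT (fun j => ccar (sp_power j)) _ (sp_tens (sp_tens x y) z) =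
    existT (fun j => ccar (sp_power j)) _ (sp_tens x (sp_tens y z));
  sp_tens1 : forall n (x : sp_power n) (a : M),
    existT (fun j => ccar (sp_power j)) _ (@sp_tens n 0 x a) =
    existT (fun j => ccar (sp_power j)) _ (ract x a);
  sp_1tens : forall n (a : M) (x : sp_power n), @sp_tens 0 n a x = lact a x;
  sp_incl_isometry : forall n, bimodule_isometry (@sp_incl n);
  sp_incl0 : forall a : M, @sp_incl 0 a = a;
  sp_incl1 : forall z : sp_power 1, exists x, sp_incl x = z;
  sp_incl_tens : forall n m (x : sp_fibre (n + m)%N),
    completion [set z | exists (y : sp_fibre n) (y' : sp_fibre m),
                          z = sp_tens (sp_incl y) (sp_incl y')]
      (sp_incl x);
  sp_complementable : forall n m (z : sp_power (n + m)%N),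
    completion [set z | exists (y : sp_fibre n) (y' : sp_fibre m),
                          z = sp_tens (sp_incl y) (sp_incl y')] z ->
    exists x : sp_fibre (n + m)%N,
      forall x', cip (sp_incl x') (z - sp_incl x) = 0
}.

Coercion sp_fibre : subproduct_system >-> Funclass.

(* The orthogonal projection p_n of E^{\otimes n} onto X(n), as a map to X(n). *)
Definition sp_proj (X : subproduct_system) (n : nat) (z : sp_power X n) : X n :=
  xget (0 : X n)
    [set x | forall x' : X n, cip (sp_incl x') (z - sp_incl x) = 0].

(* p_{n+m} (x \otimes y). *)
Definition sp_mul (X : subproduct_system) (n m : nat) (x : X n) (y : X m) :
    X (n + m)%N :=
  sp_proj (sp_tens (sp_incl x) (sp_incl y)).

(* F sits in its linking algebra, inside L(M \oplus F), as operators M -> F. The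
   norm of a k x k matrix over F is thus its norm as an operator from M^k to F^k,
   where the squared norm of (y_i) in F^k is |\sum_i <y_i, y_i>|; c ranges over
   the upper bounds of this norm. *)
Definition completely_contractive (F : correspondence) (H : hilbert)
    (T : F -> H -> H) : Prop :=
  forall (k : nat) (z : 'I_k -> 'I_k -> F) (c : C), 0 <= c ->
    (forall b : 'I_k -> M,
       let y i := \sum_(j < k) ract (z i j) (b j) in
       `|\sum_(i < k) cip (y i) (y i)|
         <= c ^+ 2 * `|\sum_(j < k) amul (astar (b j)) (b j)|) ->
    forall h : 'I_k -> H,
      \sum_(i < k) `|\sum_(j < k) T (z i j) (h j)| ^+ 2
        <= c ^+ 2 * \sum_(j < k) `|h j| ^+ 2.

Record covariant_rep (X : subproduct_system) (H : hilbert) := CovariantRep {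
  cr_map :> forall n, X n -> H -> H;
  cr_bounded : forall n (x : X n), bounded_op (cr_map x);
  cr_linear : forall n h, linear (fun x : X n => cr_map x h);
  cr_rep : @representation H (@cr_map 0);
  cr_cc : forall n, completely_contractive (@cr_map n);
  cr_continuous : forall n,
    if s is Wstar_setting V then sigma_continuous V (@cr_map n) else True;
  cr_ract : forall n (x : X n) (a : M) h,
    cr_map (ract x a) h = cr_map x (@cr_map 0 a h);
  cr_lact : forall n (x : X n) (a : M) h,
    cr_map (lact a x) h = @cr_map 0 a (cr_map x h);
  cr_mul : forall n m (x : X n) (y : X m) h,
    cr_map (sp_mul x y) h = cr_map x (cr_map y h)
}.

Definition cr_sigma (X : subproduct_system) (H : hilbert)
  (T : covariant_rep X H) : M -> H -> H := @cr_map X H T 0.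

(* Models of the Hilbert space F \otimes_pi H. *)
Record hilbert_tensor (F : correspondence) (H : hilbert) (pi : M -> H -> H) :=
  HilbertTensor {
  ht_space :> hilbert;
  ht_tens : F -> H -> ht_space;
  ht_linearl : forall h, linear (fun x => ht_tens x h);
  ht_linearr : forall x, linear (ht_tens x);
  ht_ip : forall x h x' h',
    hip (ht_tens x h) (ht_tens x' h') = hip h (pi (cip x x') h');
  ht_dense : closure (span [set z | exists x h, z = ht_tens x h]) = setT
}.

Section CovariantRepresentations.
Variables (X : subproduct_system) (H : hilbert) (T : covariant_rep X H).
Variable W : forall n, hilbert_tensor (X n) (cr_sigma T).
Variable Tt : forall n, W n -> H.

(* Such a contraction exists, by complete contractivity of T_n, and the density
   of the elementary tensors makes it unique. *)
Definition is_tilde : Prop :=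
  forall n, [/\ linear (@Tt n), forall w : W n, `|Tt w| <= `|w|
              & forall (x : X n) h, Tt (ht_tens (W n) x h) = T n x h].

Definition pure : Prop :=
  forall h, (fun n => @Tt n (adj (@Tt n) h)) @ \oo --> (0 : H).

Definition defect : H -> H :=
  psqrt (fun h => h - @Tt 1 (adj (@Tt 1) h)).

Definition rel_isometric_range : Prop :=
  forall n,
    closure (span [set z | exists (x : X n) h, z = ht_tens (W n) x (defect h)])
      `<=` range (adj (@Tt n)).

Definition rel_isometric_formula : Prop :=
  forall n (x : X n) h,
    defect (adj (T n x) (T n x (defect h))) = cr_sigma T (cip x x) (defect h).

Definition relatively_isometric : Prop :=
  (forall n, partial_isometry (@Tt n)) /\
  (rel_isometric_range \/ rel_isometric_formula).

End CovariantRepresentations.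

(* A model of the X-Fock space together with the X-shift S_n(x). *)
Record fock_space (X : subproduct_system) := FockSpace {
  fk_space :> correspondence;
  fk_admissible : admissible fk_space;
  fk_in : forall n, X n -> fk_space;
  fk_in_isometry : forall n, bimodule_isometry (@fk_in n);
  fk_in_orthogonal : forall n m (x : X n) (y : X m), n != m ->
    cip (fk_in x) (fk_in y) = 0;
  fk_dense : completion [set z | exists n (x : X n), z = fk_in x] = setT;
  fk_shift : forall n, X n -> fk_space -> fk_space;
  fk_shift_adjointable : forall n (x : X n), adjointable (fk_shift x);
  fk_shiftE : forall n m (x : X n) (y : X m),
    fk_shift x (fk_in y) = fk_in (sp_mul x y)
}.

Record cstar_subalgebra (F : correspondence) (A : set (F -> F)) : Prop :=
  CstarSubalgebra {
  sub_adjointable : forall a, A a -> adjointable a;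
  sub_zero : A (fun=> 0);
  sub_linear : forall (c : C) a b, A a -> A b -> A (fun x => c *: a x + b x);
  sub_mul : forall a b, A a -> A b -> A (fun x => a (b x));
  sub_star : forall a b, A a -> is_cadjoint a b -> A b;
  sub_closed : forall a, adjointable a ->
    (forall e : C, 0 < e ->
       exists2 b, A b & forall x, `|a x - b x| <= e * `|x|) -> A a
}.

Definition toeplitz (X : subproduct_system) (F : fock_space X) :
    set (F -> F) :=
  smallest (@cstar_subalgebra F)
    [set a | exists n (x : X n), a = fk_shift (f := F) x].

(* pi, restricted to the C*-subalgebra A of L(F), is a C*-representation. *)
Record subalgebra_rep (F : correspondence) (A : set (F -> F)) (H : hilbert)
    (pi : (F -> F) -> H -> H) : Prop := SubalgebraRep {
  srep_bounded : forall a, A a -> bounded_op (pi a);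
  srep_linear : forall (c : C) a b, A a -> A b ->
    forall h, pi (fun x => c *: a x + b x) h = c *: pi a h + pi b h;
  srep_mul : forall a b, A a -> A b ->
    forall h, pi (fun x => a (b x)) h = pi a (pi b h);
  srep_star : forall a b, A a -> is_cadjoint a b ->
    forall h k, hip (pi a h) k = hip h (pi b k);
  srep_nondegenerate :
    closure (span [set x | exists a h, A a /\ x = pi a h]) = setT
}.

Definition extends_to_cstar_rep (X : subproduct_system) (F : fock_space X)
    (H : hilbert) (T : covariant_rep X H) : Prop :=
  exists pi : (F -> F) -> H -> H,
    subalgebra_rep (@toeplitz X F) pi /\
    forall n (x : X n) h, pi (fk_shift (f := F) x) h = T n x h.

(* B = A \otimes I_D on K = F \otimes_pi D. *)
Definition is_ampliation (F : correspondence) (D : hilbert) (pi : M -> D -> D)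
    (K : hilbert_tensor F pi) (A : F -> F) (B : K -> K) : Prop :=
  bounded_op B /\
  forall x d, B (ht_tens K x d) = ht_tens K (A x) d.

(* (K, S) is the covariant representation induced by pi. *)
Definition is_induced (X : subproduct_system) (F : fock_space X)
    (D : hilbert) (pi : M -> D -> D) (K : hilbert_tensor F pi)
    (S : forall n, X n -> K -> K) : Prop :=
  forall n (x : X n), is_ampliation (fk_shift (f := F) x) (S n x).

Definition unitarily_equivalent_to_induced (X : subproduct_system)
    (F : fock_space X) (H : hilbert) (T : covariant_rep X H) : Prop :=
  exists (D : hilbert) (pi : M -> D -> D) (K : hilbert_tensor F pi)
         (S : forall n, X n -> K -> K) (U : K -> H),
  [/\ representation pi, is_induced S, unitary U
    & forall n (x : X n) k, U (S n x k) = T n x (U k)].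

End Modules.
End OperatorAlgebras.

(* Main.v *)
(* Since Tt 1 is a partial isometry, the defect operator is the projection onto the
   orthogonal complement D of the range of Tt 1, and D reduces sigma. Relative
   isometricity gives (T_n(x) d, T_n(y) h) = (d, sigma(<x, y>) h) for d in D, and
   (T_n(x) d, T_m(y) h) = 0 for n < m because T_m(y) factors through T_n and D is
   orthogonal to the range of Tt 1. Hence x (x) d |-> T_n(x) d is isometric on the
   Fock space F (x) D; purity makes it onto, so that H itself is a model of F (x) D
   on which the shift acts as T. The representation of the Toeplitz algebra sends a
   to a (x) 1: this is T_n(x) for the shifts, and its existence passes to norm limits
   because a (x) 1 is bounded for every bounded adjointable a. In the W*-setting, an
   element of F is approached by its truncations: their strong limit exists in F
   because F is self-dual. *)

(* The obstacle is the W*-setting, where the span of the fibres need not be norm dense in the Fock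
   space. For each fixed d the map f |-> f (x) d is therefore extended from that span in the
   seminorm f |-> (d, sigma(<f, f>) d)^(1/2), the norm that f (x) d is going to have. Norm density
   implies density in it, and so does convergence of truncations tested against one normal
   functional. To apply self-duality to the limit of the truncations, a bound on represented
   elements must become a bound in the norm of M; so the given faithful representation of M has to
   be isometric. This fact and the contractivity of representations share one device: a square root
   of 1 - x found by iterating a polynomial, without a unit and without spectral calculus. The
   Cauchy-Schwarz inequality in modules is used with the constant 4, since constants do not matter
   for limits; where a bound by the seminorm is required, the inequality is applied after a
   representation, where it is scalar. *)
Require Import Defs.
From HB Require Import structures.
From mathcomp Require Import all_boot all_order all_algebra.
From mathcomp Require Import complex ring lra.
From mathcomp Require Import all_classical all_reals all_analysis.

Set Implicit Arguments.
Unset Strict Implicit.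
Unset Printing Implicit Defensive.

Import Order.TTheory GRing.Theory Num.Theory.
Import numFieldNormedType.Exports.
Import Defs.

Local Open Scope classical_set_scope.
Local Open Scope ring_scope.
Local Open Scope complex_scope.

(** * Real-valued norms and limits *)

Section RealNorm.
Variable R : realType.
Local Notation C := R[i].

(* Norms take their values in R[i]; rn is the norm as an element of R. *)
Definition rn (V : normedZmodType C) (x : V) : R := complex.Re `|x|.

Lemma rnE (V : normedZmodType C) (x : V) : `|x| = (rn x)%:C.
Proof. by rewrite /rn RRe_real // ger0_real // normr_ge0. Qed.

Lemma rn_ge0 (V : normedZmodType C) (x : V) : 0 <= rn x.
Proof. by rewrite -ler0c -rnE normr_ge0. Qed.

Lemma rnD (V : normedZmodType C) (x y : V) : rn (x + y) <= rn x + rn y.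
Proof. by rewrite -lecR rmorphD /= -!rnE ler_normD. Qed.

Lemma rnN (V : normedZmodType C) (x : V) : rn (- x) = rn x.
Proof. by rewrite /rn normrN. Qed.

Lemma rnB (V : normedZmodType C) (x y : V) : rn (x - y) <= rn x + rn y.
Proof. by rewrite -(rnN y); exact: rnD. Qed.

Lemma rnBC (V : normedZmodType C) (x y : V) : rn (x - y) = rn (y - x).
Proof. by rewrite -rnN opprB. Qed.

Lemma rn0 (V : normedZmodType C) : rn (0 : V) = 0.
Proof. by rewrite /rn normr0. Qed.

Lemma rn_eq0 (V : normedZmodType C) (x : V) : rn x = 0 -> x = 0.
Proof. by move=> h; apply/eqP; rewrite -normr_eq0 rnE h. Qed.

Lemma rn_le0 (V : normedZmodType C) (x : V) : rn x <= 0 -> x = 0.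
Proof. by move=> h; apply: rn_eq0; apply/eqP; rewrite eq_le h rn_ge0. Qed.

Lemma rn_tri (V : normedZmodType C) (x y z : V) : rn (x - z) <= rn (x - y) + rn (y - z).
Proof. by have := rnD (x - y) (y - z); rewrite addrA subrK. Qed.

Lemma rnZ (V : normedModType C) (c : C) (x : V) : rn (c *: x) = rn c * rn x.
Proof. by apply: complexI; rewrite rmorphM /= -!rnE normrZ. Qed.

Lemma rnM (c d : C) : rn (c * d) = rn c * rn d.
Proof. by apply: complexI; rewrite rmorphM /= -!rnE normrM. Qed.

Lemma rn_real (r : R) : rn (r%:C) = `|r|.
Proof. by rewrite /rn normc_def /= expr0n /= addr0 sqrtr_sqr. Qed.

Lemma rn_conj (c : C) : rn (Num.conj c) = rn c.
Proof. by rewrite /rn norm_conjC. Qed.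

Lemma rn_sqr (c : C) : Num.conj c * c = ((rn c) ^+ 2)%:C.
Proof. by rewrite mulrC -normCK rnE rmorphXn. Qed.

Lemma Re_le_rn (c : C) : complex.Re c <= rn c.
Proof. by apply: le_trans (ler_norm _) _; rewrite -lecR -rnE normc_ge_Re. Qed.

Lemma lt_rn (V : normedZmodType C) (x : V) (r : R) : (`|x| < r%:C) = (rn x < r).
Proof. by rewrite rnE ltcR. Qed.

Lemma pos_complex (e : C) : 0 < e -> exists2 r : R, e = r%:C & 0 < r.
Proof.
move=> e0; exists (complex.Re e); first by rewrite RRe_real // gtr0_real.
by rewrite -ltcR RRe_real // gtr0_real.
Qed.

(** Convergence tested by real e, so that estimates live in [R], where [lra] and [nra] apply. *)
Definition tends (V : normedZmodType C) (u : nat -> V) (l : V) : Prop :=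
  forall e : R, 0 < e -> exists N : nat, forall n, (N <= n)%N -> rn (u n - l) < e.

Lemma eps_le0 (a : R) : (forall e, 0 < e -> a <= e) -> a <= 0.
Proof. by move=> h; apply/ler_addgt0Pr => e e0; rewrite add0r; exact: h. Qed.

(** Any fixed multiple of e is a good enough bound, so limit arguments need not split e in
    advance. *)
Lemma eps_le0M (a c : R) : (forall e, 0 < e -> a <= c * e) -> a <= 0.
Proof.
move=> h; apply: eps_le0 => e e0.
have c1 : 0 < `|c| + 1 by rewrite ltr_wpDl.
apply: le_trans (h (e / (`|c| + 1)) (divr_gt0 e0 c1)) _.
rewrite mulrA ler_pdivrMr //; rewrite [leRHS]mulrC.
by rewrite ler_pM2r // ; have := ler_norm c; lra.
Qed.

Lemma tends_cvg (V : normedModType C) (u : nat -> V) (l : V) :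
  tends u l <-> u @ \oo --> l.
Proof.
split=> [h|/cvgrPdistC_lt h e e0].
  apply/cvgrPdistC_lt => e /pos_complex[r -> r0].
  have [N hN] := h r r0; exists N => // n /= Nn.
  by rewrite lt_rn; exact: hN.
have := h e%:C; rewrite ltcR => /(_ e0)[N _ hN].
by exists N => n Nn; rewrite -lt_rn; exact: hN.
Qed.

Lemma tends_unique (V : normedZmodType C) (u : nat -> V) (l l' : V) :
  tends u l -> tends u l' -> l = l'.
Proof.
move=> h h'; apply/eqP; rewrite -subr_eq0; apply/eqP/rn_le0.
apply: (@eps_le0M _ 2) => e e0.
have [N hN] := h e e0; have [N' hN'] := h' e e0.
have := hN (maxn N N') (leq_maxl _ _); have := hN' (maxn N N') (leq_maxr _ _).
by have := rn_tri l (u (maxn N N')) l'; rewrite (rnBC l (u _)); lra.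
Qed.

Lemma tends_cst (V : normedZmodType C) (l : V) : tends (fun=> l) l.
Proof. by move=> e e0; exists 0%N => n _; rewrite subrr rn0. Qed.

Lemma tends_lip (V W : normedZmodType C) (u : nat -> V) (l : V) (v : nat -> W) (m : W) (c : R) :
  tends u l -> (forall n, rn (v n - m) <= c * rn (u n - l)) -> tends v m.
Proof.
move=> h hc e e0.
have c1 : 0 < `|c| + 1 by rewrite ltr_wpDl.
have [N hN] := h (e / (`|c| + 1)) (divr_gt0 e0 c1).
exists N => n /hN; rewrite ltr_pdivlMr // => H.
apply: le_lt_trans (hc n) _; apply: le_lt_trans H.
rewrite mulrC ler_wpM2l ?rn_ge0 //; have := ler_norm c; lra.
Qed.

Lemma tendsD (V : normedZmodType C) (u v : nat -> V) (l m : V) :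
  tends u l -> tends v m -> tends (fun n => u n + v n) (l + m).
Proof.
move=> h h' e e0; have e2 : 0 < e / 2 by rewrite divr_gt0.
have [N hN] := h _ e2; have [N' hN'] := h' _ e2.
exists (maxn N N') => n; rewrite geq_max => /andP[/hN a /hN' b].
rewrite opprD addrACA; have := rnD (u n - l) (v n - m); lra.
Qed.

Lemma tendsZ (V : normedModType C) (c : C) (u : nat -> V) (l : V) :
  tends u l -> tends (fun n => c *: u n) (c *: l).
Proof.
move=> h; apply: (tends_lip (c := rn c)) h _ => n.
by rewrite -scalerBr rnZ.
Qed.

Lemma tends_rn_le (V : normedZmodType C) (u : nat -> V) (l : V) (c : R) :
  tends u l -> (exists N, forall n, (N <= n)%N -> rn (u n) <= c) -> rn l <= c.
Proof.
move=> h [N' hc]; rewrite -subr_le0; apply: eps_le0 => e e0.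
have [N hN] := h e e0; have := hN (maxn N N') (leq_maxl _ _).
have := hc _ (leq_maxr N N'); have := rn_tri l (u (maxn N N')) 0.
by rewrite !subr0 (rnBC l (u _)); lra.
Qed.

Lemma tends_ext (V : normedZmodType C) (u v : nat -> V) (l : V) :
  u =1 v -> tends u l -> tends v l.
Proof. by move=> /funext ->. Qed.

Lemma tends_shift (V : normedZmodType C) (u : nat -> V) (l : V) :
  tends u l -> tends (fun n => u n.+1) l.
Proof. by move=> h e /h[N hN]; exists N => n Nn; apply: hN; exact: leqW. Qed.

Lemma cauchy_tends (V : completeNormedModType C) (u : nat -> V) :
  (forall e : R, 0 < e -> exists N : nat, forall m n, (N <= m)%N -> (N <= n)%N ->
     rn (u m - u n) < e) ->
  exists l, tends u l.
Proof.
move=> h; suff /cvg_ex[l ul] : cvg (u @ \oo) by exists l; apply/tends_cvg.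
apply: cauchy_cvg; apply: cauchy_exP => e /pos_complex[r -> r0].
have [N hN] := h r r0; exists (u N); exists N => // n /= Nn.
by rewrite -ball_normE /ball_ /= lt_rn; exact: hN.
Qed.

Lemma geometric_tends (V : completeNormedModType C) (u : nat -> V) (c r : R) :
  0 <= r < 1 -> (forall n, rn (u n.+1 - u n) <= c * r ^+ n) ->
  exists l, tends u l.
Proof.
move=> /andP[r0 r1] h.
have c0 : 0 <= c by have := le_trans (rn_ge0 _) (h 0%N); rewrite expr0 mulr1.
have hk n k : rn (u (n + k)%N - u n) <= c * r ^+ n / (1 - r).
  have : rn (u (n + k)%N - u n) <= c * r ^+ n * (1 - r ^+ k) / (1 - r).
    elim: k => [|k IH]; first by rewrite addn0 subrr rn0 expr0 subrr mulr0 mul0r.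
    have := rn_tri (u (n + k.+1)%N) (u (n + k)%N) (u n).
    have := h (n + k)%N; rewrite addnS exprD => a b.
    have := le_trans b (lerD a IH); move/le_trans; apply.
    rewrite [r ^+ k.+1]exprS le_eqVlt; apply/orP; left; apply/eqP.
    by field; lra.
  move/le_trans; apply.
  apply: ler_wpM2r; first by rewrite invr_ge0 subr_ge0 ltW.
  apply: ler_piMr; first by rewrite mulr_ge0 ?exprn_ge0.
  by have := exprn_ge0 k r0; lra.
apply: cauchy_tends => e e0.
have rr : `|r| < 1 by rewrite ger0_norm.
(* Below this value of r^N each half of the Cauchy difference is less than e / 2; [c + 1] instead of
   [c] covers c = 0. *)
have d0 : 0 < e * (1 - r) / (2 * (c + 1)).
  by rewrite divr_gt0 ?mulr_gt0 //; lra.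
have /cvgrPdist_lt /(_ _ d0)[N _ hN] := cvg_expr rr.
exists N => m n /subnKC <- /subnKC <-.
have := rn_tri (u (N + (m - N))%N) (u N) (u (N + (n - N))%N).
have := hk N (m - N)%N; have := hk N (n - N)%N; rewrite (rnBC (u N)).
have := hN N (leqnn N); rewrite /= sub0r normrN ger0_norm ?exprn_ge0 // => H.
have : c * r ^+ N / (1 - r) < e / 2.
  rewrite ltr_pdivrMr; last lra.
  rewrite ltr_pdivlMr in H; last lra.
  have := exprn_ge0 N r0; nra.
lra.
Qed.

Lemma closure_rn (V : normedModType C) (A : set V) (x : V) :
  closure A x <-> forall e : R, 0 < e -> exists2 y, A y & rn (x - y) < e.
Proof.
split=> [h e e0|h B /nbhs_ballP[e /= /pos_complex[r -> r0] hB]].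
  have [|y [Ay]] := h (ball x e%:C).
    by apply: nbhsx_ballx; rewrite ltcR.
  by rewrite -ball_normE /ball_ /= lt_rn; exists y.
have [y Ay xy] := h r r0; exists y; split=> //; apply: hB.
by rewrite -ball_normE /ball_ /= lt_rn.
Qed.

Lemma closure_seq (V : normedModType C) (A : set V) (x : V) :
  closure A x -> exists2 u : nat -> V, (forall n, A (u n)) & tends u x.
Proof.
move=> /closure_rn h.
have /choice[u hu] n : exists y, A y /\ rn (x - y) < n.+1%:R^-1.
  by have [y] := h n.+1%:R^-1 (ltac:(by rewrite invr_gt0)); exists y.
exists u => [n|e e0]; first by have [] := hu n.
have [N _ hN] := near_infty_natSinv_lt (PosNum e0).
by exists N => n Nn; rewrite rnBC; apply: lt_trans (hu n).2 (hN n Nn).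
Qed.

Lemma null_seq : exists2 dl : nat -> R, (forall n, 0 < dl n) &
  forall e, 0 < e -> exists N, forall n, (N <= n)%N -> dl n < e.
Proof.
exists (fun n => n.+1%:R^-1) => [n|e e0]; first by rewrite invr_gt0.
by have [N _ hN] := near_infty_natSinv_lt (PosNum e0); exists N => n; exact: hN.
Qed.

End RealNorm.

(** * Linear maps, bounded operators and spans *)

Section LinearMaps.
Variable R : realType.
Local Notation C := R[i].

Lemma linD (V W : lmodType C) (f : V -> W) : linear f -> forall x y, f (x + y) = f x + f y.
Proof. by move=> h x y; have := h 1 x y; rewrite !scale1r. Qed.

Lemma lin0 (V W : lmodType C) (f : V -> W) : linear f -> f 0 = 0.
Proof. by move=> h; apply: (addrI (f 0)); rewrite -linD // !addr0. Qed.

Lemma linZ (V W : lmodType C) (f : V -> W) : linear f -> forall c x, f (c *: x) = c *: f x.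
Proof. by move=> h c x; have := h c x 0; rewrite !addr0 lin0 // addr0. Qed.

Lemma linN (V W : lmodType C) (f : V -> W) : linear f -> forall x, f (- x) = - f x.
Proof. by move=> h x; rewrite -scaleN1r linZ // scaleN1r. Qed.

Lemma linB (V W : lmodType C) (f : V -> W) : linear f -> forall x y, f (x - y) = f x - f y.
Proof. by move=> h x y; rewrite linD // linN. Qed.

Lemma bounded_rn (V W : normedModType C) (f : V -> W) :
  bounded_op f <-> linear f /\ exists2 c : R, 0 <= c & forall x, rn (f x) <= c * rn x.
Proof.
split=> -[lf [c]].
  (* The constant in [bounded_op] is complex; only its real part enters the comparison, and the
     absolute value makes it nonnegative. *)
  move=> hc; split=> //; exists (`|complex.Re c|) => // x.
  have := hc x; rewrite !rnE lecE => /andP[/eqP _].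
  move/le_trans; apply.
  have -> : complex.Re (c * (rn x)%:C) = complex.Re c * rn x.
    by case: (c) => a b /=; rewrite mulr0 subr0.
  by rewrite ler_wpM2r ?rn_ge0 // ler_norm.
move=> c0 hc; split=> //; exists c%:C => x.
by rewrite !rnE -rmorphM lecR.
Qed.

Lemma bounded_tends (V W : normedModType C) (f : V -> W) : bounded_op f ->
  forall u l, tends u l -> tends (fun n => f (u n)) (f l).
Proof.
move=> /bounded_rn[lf [c c0 hc]] u l ul; apply: (tends_lip (c := c)) ul _ => n.
by rewrite -linB.
Qed.

Lemma bounded_opD (V W : normedModType C) (f g : V -> W) (c : C) :
  bounded_op f -> bounded_op g -> bounded_op (fun x => c *: f x + g x).
Proof.
move=> /bounded_rn[lf [a a0 ha]] /bounded_rn[lg [b b0 hb]].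
apply/bounded_rn; split=> [k x y|].
  by rewrite lf lg !scalerDr addrACA !scalerA [c * k]mulrC.
exists (rn c * a + b) => [|x]; first by rewrite addr_ge0 ?mulr_ge0 ?rn_ge0.
apply: le_trans (rnD _ _) _; rewrite rnZ mulrDl lerD //.
by rewrite -mulrA ler_wpM2l ?rn_ge0.
Qed.

Lemma bounded_op_comp (U V W : normedModType C) (f : V -> W) (g : U -> V) :
  bounded_op f -> bounded_op g -> bounded_op (fun x => f (g x)).
Proof.
move=> /bounded_rn[lf [a a0 ha]] /bounded_rn[lg [b b0 hb]].
apply/bounded_rn; split=> [k x y|]; first by rewrite lg lf.
exists (a * b) => [|x]; first by rewrite mulr_ge0.
by apply: le_trans (ha _) _; rewrite -mulrA ler_wpM2l.
Qed.

Lemma bounded_op0 (V W : normedModType C) : bounded_op (fun _ : V => 0 : W).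
Proof.
apply/bounded_rn; split=> [k x y|]; first by rewrite scaler0 addr0.
by exists 0 => // x; rewrite rn0 mul0r.
Qed.

Lemma bounded_op_id (V : normedModType C) : bounded_op (fun x : V => x).
Proof. by apply/bounded_rn; split=> //; exists 1 => // x; rewrite mul1r. Qed.

Definition subspace (V : lmodType C) (S : set V) : Prop :=
  S 0 /\ forall c x y, S x -> S y -> S (c *: x + y).

Lemma span_subspace (V : lmodType C) (S : set V) : subspace (span S).
Proof.
split; first by exists 0%N, (fun=> 0), (fun=> 0); split=> [[]//|]; rewrite big_ord0.
move=> c x y [n [a [v [hv ->]]]] [m [b [w [hw ->]]]].
exists (n + m)%N, (fun i => match fintype.split i with inl j => c * a j | inr j => b j end),
  (fun i => match fintype.split i with inl j => v j | inr j => w j end); split.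
  by move=> i; case: (fintype.split i).
rewrite big_split_ord /= scaler_sumr; congr (_ + _); apply: eq_bigr => i _.
  by rewrite (unsplitK (inl i)) scalerA.
by rewrite (unsplitK (inr i)).
Qed.

Lemma mem_span (V : lmodType C) (S : set V) (x : V) : S x -> span S x.
Proof. by move=> Sx; exists 1%N, (fun=> 1), (fun=> x); split=> //; rewrite big_ord1 scale1r. Qed.

Lemma span_ind (V : lmodType C) (S P : set V) :
  subspace P -> S `<=` P -> span S `<=` P.
Proof.
move=> [P0 PD] SP x [n [c [v [hv ->]]]].
elim: n c v hv => [|n IH] c v hv; first by rewrite big_ord0.
rewrite big_ord_recr /= addrC; apply: PD; first exact/SP/hv.
by apply: IH => i; exact: hv.
Qed.

Lemma subspaceZ (V : lmodType C) (S : set V) c x : subspace S -> S x -> S (c *: x).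
Proof. by move=> [S0 h] Sx; have := h c x 0 Sx S0; rewrite addr0. Qed.

Lemma subspaceD (V : lmodType C) (S : set V) x y : subspace S -> S x -> S y -> S (x + y).
Proof. by move=> [S0 h] Sx Sy; have := h 1 x y Sx Sy; rewrite scale1r. Qed.

End LinearMaps.

(** * Hilbert spaces *)

Section Hilbert.
Variable R : realType.
Local Notation C := R[i].
Variable H : hilbert R.
Implicit Types x y z : H.

Lemma hipDr x y z : hip x (y + z) = hip x y + hip x z.
Proof. by have := hip_linear x 1 y z; rewrite scale1r mul1r. Qed.

Lemma hip0r x : hip x 0 = 0.
Proof. by apply: (addrI (hip x 0)); rewrite -hipDr !addr0. Qed.

Lemma hipZr x c y : hip x (c *: y) = c * hip x y.
Proof. by have := hip_linear x c y 0; rewrite !addr0 hip0r addr0. Qed.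

Lemma hipNr x y : hip x (- y) = - hip x y.
Proof. by rewrite -scaleN1r hipZr mulN1r. Qed.

Lemma hipBr x y z : hip x (y - z) = hip x y - hip x z.
Proof. by rewrite hipDr hipNr. Qed.

Lemma hipDl x y z : hip (x + y) z = hip x z + hip y z.
Proof. by rewrite hip_conj hipDr rmorphD /= -!hip_conj. Qed.

Lemma hipZl c x y : hip (c *: x) y = Num.conj c * hip x y.
Proof. by rewrite hip_conj hipZr rmorphM /= -hip_conj. Qed.

Lemma hip0l x : hip 0 x = 0.
Proof. by rewrite hip_conj hip0r rmorph0. Qed.

Lemma hipNl x y : hip (- x) y = - hip x y.
Proof. by rewrite hip_conj hipNr rmorphN /= -hip_conj. Qed.

Lemma hipBl x y z : hip (x - y) z = hip x z - hip y z.
Proof. by rewrite hipDl hipNl. Qed.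

Lemma hip_self x : hip x x = ((rn x) ^+ 2)%:C.
Proof. by rewrite -hip_norm rnE rmorphXn. Qed.

Lemma rn_hip x : (rn x) ^+ 2 = complex.Re (hip x x).
Proof. by rewrite hip_self. Qed.

Lemma hip_ge0 x : 0 <= hip x x.
Proof. by rewrite hip_self ler0c sqr_ge0. Qed.

Lemma hip_eq0 x : hip x x = 0 -> x = 0.
Proof. by rewrite hip_self => /complexI /eqP; rewrite sqrf_eq0 => /eqP/rn_eq0. Qed.

Lemma hip0C x y : hip x y = 0 -> hip y x = 0.
Proof. by rewrite (hip_conj x y) => ->; rewrite rmorph0. Qed.

Lemma Re_conj (c : C) : complex.Re (Num.conj c) = complex.Re c.
Proof. by case: c. Qed.

Lemma rn_sqrD x y : rn (x + y) ^+ 2 = rn x ^+ 2 + 2 * complex.Re (hip x y) + rn y ^+ 2.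
Proof.
rewrite !rn_hip hipDl !hipDr !raddfD /= (hip_conj x y) Re_conj; ring.
Qed.

Lemma rn_sqrB x y : rn (x - y) ^+ 2 = rn x ^+ 2 - 2 * complex.Re (hip x y) + rn y ^+ 2.
Proof. rewrite rn_sqrD hipNr raddfN /= rnN; ring. Qed.

Lemma cauchy_schwarz x y : rn (hip x y) <= rn x * rn y.
Proof.
have re (u v : H) : complex.Re (hip u v) <= rn u * rn v.
  have [v0|v0] := eqVneq (rn v) 0.
    by rewrite (rn_eq0 v0) hip0r rn0 mulr0.
  have vp : 0 < rn v by rewrite lt_def v0 rn_ge0.
  have [u0|u0] := eqVneq (rn u) 0.
    by rewrite (rn_eq0 u0) hip0l rn0 mul0r.
  have up : 0 < rn u by rewrite lt_def u0 rn_ge0.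
  (* The squared norm of this vector is 2 |u| |v| (|u| |v| - Re (u, v)). *)
  have := sqr_ge0 (rn ((rn v)%:C *: u - (rn u)%:C *: v)).
  rewrite rn_sqrB !rnZ !rn_real !ger0_norm ?rn_ge0 // hipZl hipZr.
  have -> : Num.conj (rn v)%:C = (rn v)%:C :> C by apply/CrealP; rewrite complex_real.
  rewrite mulrA -rmorphM /=.
  case: (hip u v) => a b /=; rewrite mul0r subr0.
  have : 0 < rn u * rn v by rewrite mulr_gt0.
  nra.
have [c0|c0] := eqVneq (rn (hip x y)) 0; first by rewrite c0 mulr_ge0 ?rn_ge0.
have cp : 0 < rn (hip x y) by rewrite lt_def c0 rn_ge0.
(* Multiplying y by the conjugate of (x, y) turns the real part into |(x, y)|^2. *)
have := re x (Num.conj (hip x y) *: y).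
rewrite hipZr rn_sqr /= rnZ rn_conj mulrCA expr2.
by rewrite ler_pM2l.
Qed.

Lemma hip_lim x (u : nat -> H) y : tends u y -> tends (fun n => hip x (u n)) (hip x y).
Proof.
move=> h; apply: (tends_lip (c := rn x)) h _ => n.
by rewrite -hipBr cauchy_schwarz.
Qed.

Lemma hip_liml x (u : nat -> H) y : tends u y -> tends (fun n => hip (u n) x) (hip y x).
Proof.
move=> h; apply: (tends_lip (c := rn x)) h _ => n.
by rewrite -hipBl mulrC cauchy_schwarz.
Qed.

Lemma hip_ext x y : (forall z, hip z x = hip z y) -> x = y.
Proof.
move=> h; apply/eqP; rewrite -subr_eq0; apply/eqP/hip_eq0.
by rewrite [LHS]hipBr h subrr.
Qed.

Lemma orth_subspace (v : H) : subspace [set x | hip x v = 0].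
Proof.
split=> [|c x y /= hx hy]; first by rewrite /= hip0l.
by rewrite hipDl hipZl hx hy mulr0 addr0.
Qed.

Lemma orth_closure (S : set H) v : (forall x, S x -> hip x v = 0) ->
  forall x, closure S x -> hip x v = 0.
Proof.
move=> h x /closure_seq[u Su ux].
apply: (tends_unique (hip_liml v ux)).
by apply: tends_ext (tends_cst _) => n; rewrite h.
Qed.

(** A sequence in S minimizing the distance to v is Cauchy by the parallelogram law; as S is not
    assumed closed, its limit is only in the closure. *)
Theorem projection (S : set H) (v : H) : subspace S ->
  exists2 p, closure S p & forall x, S x -> hip x (v - p) = 0.
Proof.
move=> sS; have [S0 SD] := sS.
pose A : set R := [set r | exists2 x, S x & r = rn (v - x) ^+ 2].
have A0 : A (rn (v - 0) ^+ 2) by exists 0.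
have lbA : lbound A 0 by move=> r [x _ ->]; exact: sqr_ge0.
have infA : has_inf A by split; [exists (rn (v - 0) ^+ 2) | exists 0].
pose d := inf A.
have dle x : S x -> d <= rn (v - x) ^+ 2.
  by move=> Sx; apply: inf_lbound; [case: infA | exists x].
have [dl dl0 dlN] := null_seq R.
have /choice[u hu] n : exists x, S x /\ rn (v - x) ^+ 2 < d + dl n.
  have [r [x Sx ->] h] := @inf_adherent _ A (dl n) (dl0 n) infA.
  by exists x.
(* The midpoint of x and y lies in S, so its squared distance to v is at least d. *)
have par (x y : H) : S x -> S y -> rn (x - y) ^+ 2 <=
    2 * (rn (v - x) ^+ 2 - d) + 2 * (rn (v - y) ^+ 2 - d).
  move=> Sx Sy.
  have := dle (2^-1 *: (x + y)) (subspaceZ _ sS (subspaceD sS Sx Sy)).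
  have e : (v - x) + (v - y) = (2 : C) *: (v - 2^-1 *: (x + y)).
    rewrite scalerBr scalerA divff ?pnatr_eq0 // scale1r scaler_nat mulr2n.
    by rewrite addrACA opprD.
  have : rn ((v - x) + (v - y)) ^+ 2 = 4 * rn (v - 2^-1 *: (x + y)) ^+ 2.
    rewrite e rnZ exprMn; congr (_ * _).
    have -> : (2 : C) = (2 : R)%:C by rewrite rmorph_nat.
    by rewrite rn_real ger0_norm // -natrX.
  have -> : x - y = (v - y) - (v - x) by rewrite opprB [RHS]addrC addrA subrK.
  rewrite (rn_sqrB (v - y)) (rn_sqrD (v - x)) (hip_conj (v - x) (v - y)) Re_conj; lra.
have [p up] : exists p, tends u p.
  apply: cauchy_tends => e e0.
  have e4 : 0 < e ^+ 2 / 4 by rewrite divr_gt0 // exprn_gt0.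
  have [N hN] := dlN _ e4.
  exists N => m n Nm Nn; rewrite -(ltr_pXn2r (n := 2)) ?nnegrE ?rn_ge0 ?ltW //.
  apply: le_lt_trans (par _ _ (hu m).1 (hu n).1) _.
  have := (hu m).2; have := (hu n).2; have := hN m Nm; have := hN n Nn; lra.
exists p.
  apply/closure_rn => e e0; have [N hN] := up e e0; exists (u N); first by have [] := hu N.
  by rewrite rnBC; exact: hN.
have dp : rn (v - p) ^+ 2 <= d.
  have : rn (v - p) <= Num.sqrt d.
    have -> : rn (v - p) = rn (v - p - 0) by rewrite subr0.
    apply/ler_addgt0Pr => e e0.
    have d0 : 0 <= d by apply: lb_le_inf => //; exists (rn (v - 0) ^+ 2).
    have s0 := sqrtr_ge0 d.
    have e20 : 0 < (e / 2) ^+ 2 by rewrite exprn_gt0 ?divr_gt0.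
    have [N hN] := dlN _ e20.
    have [N' hN'] := up _ (divr_gt0 e0 (ltr0Sn R 1)).
    set n := maxn N N'.
    have h1 : rn (v - u n) <= Num.sqrt d + e / 2.
      rewrite -(ler_pXn2r (n := 2)) ?nnegrE ?rn_ge0 ?addr_ge0 ?divr_ge0 // ?ltW //.
      have := (hu n).2; have := hN n (leq_maxl _ _).
      have := sqr_sqrtr d0; nra.
    have := hN' n (leq_maxr _ _); have := rn_tri v (u n) p; rewrite subr0; lra.
  have d0 : 0 <= d by apply: lb_le_inf => //; exists (rn (v - 0) ^+ 2).
  by rewrite -(ler_pXn2r (n := 2)) ?nnegrE ?rn_ge0 ?sqrtr_ge0 // sqr_sqrtr.
have dlep x : S x -> d <= rn (v - p - x) ^+ 2.
  move=> Sx.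
  have dd n : Num.sqrt d <= rn (v - p - x) + rn (u n - p).
    have := dle (u n + x) (subspaceD sS (hu n).1 Sx).
    have d0 : 0 <= d by apply: lb_le_inf => //; exists (rn (v - 0) ^+ 2).
    move=> h; have : Num.sqrt d <= rn (v - (u n + x)).
      by rewrite -(ler_pXn2r (n := 2)) ?nnegrE ?rn_ge0 ?sqrtr_ge0 // sqr_sqrtr.
    have -> : v - (u n + x) = (v - p - x) - (u n - p).
      by rewrite opprB addrACA subrK -opprD [x + _]addrC.
    by move/le_trans; apply; exact: rnB.
  have d0 : 0 <= d by apply: lb_le_inf => //; exists (rn (v - 0) ^+ 2).
  rewrite -(sqr_sqrtr d0) ler_pXn2r ?nnegrE ?rn_ge0 ?sqrtr_ge0 //.
  apply/ler_addgt0Pr => e e0; have [N hN] := up e e0.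
  by have := dd N; have := hN N (leqnn N); lra.
move=> x Sx; apply: hip0C.
have [x0|x0] := eqVneq (rn x) 0; first by rewrite (rn_eq0 x0) hip0r.
have xp : 0 < rn x by rewrite lt_def x0 rn_ge0.
set c := hip (v - p) x.
apply: rn_eq0; apply/eqP; rewrite eq_le rn_ge0 andbT.
(* The multiple of x nearest to v - p: subtracting it lowers the squared distance by |c|^2 / |x|^2,
   which minimality forbids unless c = 0. *)
have := dlep ((Num.conj c / (rn x ^+ 2)%:C) *: x) (subspaceZ _ sS Sx).
rewrite rn_sqrB hipZr -/c mulrAC rn_sqr -fmorphV -rmorphM /= rnZ rnM rn_conj rn_real.
rewrite ger0_norm ?invr_ge0 ?sqr_ge0 // => h.
have h2 := le_trans dp h; rewrite -subr_ge0 in h2; move: h2.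
have -> : rn (v - p) ^+ 2 - 2 * (rn c ^+ 2 / rn x ^+ 2) +
  (rn c * (rn x ^+ 2)^-1 * rn x) ^+ 2 - rn (v - p) ^+ 2 = - (rn c ^+ 2 / rn x ^+ 2).
  by field.
rewrite oppr_ge0 pmulr_lle0 ?invr_gt0 ?exprn_gt0 // => h3.
by rewrite -(ler_pXn2r (n := 2)) ?nnegrE ?rn_ge0 // expr0n.
Qed.

Lemma total_dense (S : set H) : (forall v, (forall x, S x -> hip x v = 0) -> v = 0) ->
  closure (span S) = setT.
Proof.
move=> h; apply/seteqP; split=> // v _.
have [p cp hp] := projection v (span_subspace S).
suff -> : v = p by [].
by apply/eqP; rewrite -subr_eq0; apply/eqP/h => x Sx; apply/hp/mem_span.
Qed.

Lemma dense_total (S : set H) : closure (span S) = setT ->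
  forall v, (forall x, S x -> hip x v = 0) -> v = 0.
Proof.
move=> h v hv; apply: hip_eq0.
apply: (@orth_closure (span S)); last by rewrite h.
by apply: span_ind => //; exact: orth_subspace.
Qed.

Lemma riesz (f : H -> C) (c : R) : linear (f : H -> C^o) -> (forall x, rn (f x) <= c * rn x) ->
  exists v, forall x, f x = hip v x.
Proof.
move=> lf hc.
have [hf|/existsNP[w hw]] := pselect (forall x, f x = 0).
  by exists 0 => x; rewrite hip0l hf.
pose K : set H := [set x | f x = 0].
have sK : subspace K.
  by split=> [|a x y /= hx hy]; [exact: (lin0 lf) | rewrite /K /= lf hx hy scaler0 addr0].
have [p cp hp] := projection w sK.
have fp : f p = 0.
  have [u Ku up] := closure_seq cp.
  have : tends (fun n => f (u n)) (f p).
    by apply: (tends_lip (c := c)) up _ => n; rewrite -(linB lf).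
  by move/tends_unique; apply; apply: tends_ext (tends_cst _) => n; rewrite Ku.
set z := w - p.
have fz : f z != 0 by rewrite (linB lf) fp subr0; apply/eqP.
have z0 : hip z z != 0.
  apply: contra fz => /eqP/hip_eq0 ->; by rewrite (lin0 lf).
(* For every x, the vector x - (f x / f z) z lies in the kernel and so is orthogonal to z; this
   forces the multiple of z. *)
exists (Num.conj (f z / hip z z) *: z) => x.
rewrite hipZl conjCK.
have : hip (x - (f x / f z) *: z) z = 0.
  apply: hp; rewrite /K /= (linB lf) (linZ lf) /GRing.scale /= divfK // subrr //.
rewrite hipBl hipZl => /eqP; rewrite subr_eq0 => /eqP e.
have : hip z x = (f x / f z) * hip z z.
  by rewrite hip_conj e rmorphM /= conjCK -hip_conj.
move=> ->; field; apply/andP; split; assumption.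
Qed.

End Hilbert.

(** * Adjoints and square roots of projections *)

Section Adjoints.
Variable R : realType.
Local Notation C := R[i].

Lemma adj_exists (H K : hilbert R) (A : H -> K) : bounded_op A ->
  exists B : K -> H, bounded_op B /\ forall x y, hip (A x) y = hip x (B y).
Proof.
move=> /bounded_rn[lA [c c0 hA]].
have /choice[B hB] (y : K) : exists v : H, forall x, hip y (A x) = hip v x.
  apply: (@riesz _ _ (fun x => hip y (A x)) (rn y * c)) => [k u v|x].
    by rewrite lA hip_linear.
  apply: le_trans (cauchy_schwarz _ _) _.
  by rewrite -mulrA ler_wpM2l ?rn_ge0.
have adjB x y : hip (A x) y = hip x (B y) by rewrite hip_conj hB -hip_conj.
exists B; split=> //; apply/bounded_rn; split=> [k u v|].
  by apply: hip_ext => z; rewrite hip_linear -!adjB hip_linear.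
exists c => // y.
have [->|b0] := eqVneq (rn (B y)) 0; first by rewrite mulr_ge0 ?rn_ge0.
have bp : 0 < rn (B y) by rewrite lt_def b0 rn_ge0.
rewrite -(ler_pM2r bp) -expr2 rn_hip -adjB.
apply: le_trans (Re_le_rn _) _; apply: le_trans (cauchy_schwarz _ _) _.
by rewrite [leRHS]mulrAC ler_wpM2r ?rn_ge0.
Qed.

Lemma adjP (H K : hilbert R) (A : H -> K) : bounded_op A ->
  bounded_op (adj A) /\ forall x y, hip (A x) y = hip x (adj A y).
Proof. by move=> /adj_exists h; exact: (xgetPex _ h). Qed.

Lemma adj_bounded (H K : hilbert R) (A : H -> K) : bounded_op A -> bounded_op (adj A).
Proof. by move=> /adjP[]. Qed.

Lemma hip_adjr (H K : hilbert R) (A : H -> K) : bounded_op A ->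
  forall x y, hip (A x) y = hip x (adj A y).
Proof. by move=> /adjP[]. Qed.

Lemma hip_adjl (H K : hilbert R) (A : H -> K) : bounded_op A ->
  forall x y, hip (adj A x) y = hip x (A y).
Proof. by move=> bA x y; rewrite hip_conj -hip_adjr // -hip_conj. Qed.

(** Complex polarization: reality of the quadratic form at x + y and at x + i y gives two relations
    whose sum is twice the claim. *)
Lemma positive_selfadjoint (H : hilbert R) (B : H -> H) : linear B ->
  (forall x, 0 <= hip x (B x)) -> forall x y, hip (B x) y = hip x (B y).
Proof.
move=> lB pB x y.
have h z : hip (B z) z = hip z (B z).
  by rewrite hip_conj; apply/CrealP; rewrite ger0_real.
have := h (x + y); have := h (x + 'i%R *: y).
rewrite !(linD lB) (linZ lB) !hipDl !hipDr !hipZl !hipZr !h conjCi => e1 e2.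
move: (hip (B x) y) (hip (B y) x) (hip x (B y)) (hip y (B x)) (hip x (B x)) (hip y (B y)) e1 e2.
move=> p q r t a b e1 e2.
have a1 : p + q = r + t.
  by apply/eqP; rewrite -subr_eq0; apply/eqP; move/eqP: e2; rewrite -subr_eq0 => /eqP <-; ring.
have a2 : p - q = r - t.
  apply: (mulfI (neq0Ci C)); apply/eqP; rewrite -subr_eq0; apply/eqP.
  by move/eqP: e1; rewrite -subr_eq0 => /eqP <-; ring.
have e3 : 2 * p = 2 * r.
  have := congr2 +%R a1 a2.
  by rewrite addrACA subrr addr0 [RHS]addrACA subrr addr0 !mulr_natl !mulr2n.
by apply: (mulfI _ e3); rewrite pnatr_eq0.
Qed.

(* On ker P the square root vanishes, and on the range of P it is a positive
   square root of the identity, whence B y = - y for y = B x - x. *)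
Lemma psqrt_projection (H : hilbert R) (P : H -> H) : bounded_op P ->
  (forall x y, hip (P x) y = hip x (P y)) -> (forall x, P (P x) = P x) ->
  psqrt P = P.
Proof.
move=> bP sP PP; have lP := proj1 bP.
have ex : exists B : H -> H, [/\ bounded_op B, forall x, 0 <= hip x (B x)
                        & forall x, B (B x) = P x].
  by exists P; split=> // x; rewrite -PP -sP hip_ge0.
have [bB pB BB] := xgetPex (0 : H -> H) ex.
rewrite -/(psqrt P) in bB pB BB; set B := psqrt P in bB pB BB *.
have lB := proj1 bB; have sB := positive_selfadjoint lB pB.
have BP x : B (P x) = P (B x) by rewrite -BB BB.
have ker x : B x = B (P x).
  apply/eqP; rewrite -subr_eq0 -(linB lB); apply/eqP/hip_eq0.
  by rewrite sB BB (linB lP) PP subrr hip0r.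
apply/funext => x; rewrite ker.
set z := P x; have Bz : B (B z) = z by rewrite BB PP.
set y := B z - z.
have By : B y = - y by rewrite (linB lB) Bz opprB.
have := pB y; rewrite By hipNr oppr_ge0 => y0.
have : hip y y = 0 by apply/le_anti; rewrite y0 hip_ge0.
by move/hip_eq0/eqP; rewrite subr_eq0 => /eqP.
Qed.

End Adjoints.

(** * C*-algebras *)

Section Algebra.
Variable R : realType.
Local Notation C := R[i].
Variable M : cstar_algebra R.
Implicit Types a b c x : M.

Lemma lin_amul a : linear (amul a).
Proof. by move=> k x y; exact: amul_linearr. Qed.

Lemma lin_amulr a : linear (fun x => amul x a).
Proof. by move=> k x y; exact: amul_linearl. Qed.

Lemma amulDr a b c : amul a (b + c) = amul a b + amul a c.
Proof. exact: linD (lin_amul a) _ _. Qed.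
Lemma amulDl a b c : amul (b + c) a = amul b a + amul c a.
Proof. exact: linD (lin_amulr a) _ _. Qed.
Lemma amulBr a b c : amul a (b - c) = amul a b - amul a c.
Proof. exact: linB (lin_amul a) _ _. Qed.
Lemma amulBl a b c : amul (b - c) a = amul b a - amul c a.
Proof. exact: linB (lin_amulr a) _ _. Qed.
Lemma amulZr a (k : C) b : amul a (k *: b) = k *: amul a b.
Proof. exact: linZ (lin_amul a) _ _. Qed.
Lemma amulZl a (k : C) b : amul (k *: b) a = k *: amul b a.
Proof. exact: linZ (lin_amulr a) _ _. Qed.
Lemma amul0r a : amul a 0 = 0.
Proof. exact: lin0 (lin_amul a). Qed.
Lemma amul0l a : amul 0 a = 0.
Proof. exact: lin0 (lin_amulr a). Qed.

Lemma astarD a b : astar (a + b) = astar a + astar b.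
Proof. by have := astar_semilinear 1 a b; rewrite rmorph1 !scale1r. Qed.

Lemma astar0 : astar (0 : M) = 0.
Proof. by apply: (addrI (astar 0)); rewrite -astarD !addr0. Qed.

Lemma astarZ (k : C) a : astar (k *: a) = Num.conj k *: astar a.
Proof. by have := astar_semilinear k a 0; rewrite astar0 !addr0. Qed.

Lemma astarB a b : astar (a - b) = astar a - astar b.
Proof. by rewrite astarD -scaleN1r astarZ rmorphN1 scaleN1r. Qed.

Lemma rn_amul a b : rn (amul a b) <= rn a * rn b.
Proof. by have := amul_norm a b; rewrite !rnE -rmorphM lecR. Qed.

Lemma rn_astar_mul a : rn (amul (astar a) a) = rn a ^+ 2.
Proof. by have := astar_norm a; rewrite !rnE -rmorphXn => /complexI. Qed.

Lemma rn_astar a : rn (astar a) = rn a.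
Proof.
have le b : rn b <= rn (astar b).
  have [->|b0] := eqVneq (rn b) 0; first exact: rn_ge0.
  have bp : 0 < rn b by rewrite lt_def b0 rn_ge0.
  by rewrite -(ler_pM2r bp) -expr2 -rn_astar_mul rn_amul.
by apply/le_anti; rewrite le andbT -{2}(astarK a) le.
Qed.

(* The fixed point b = (x + b^2) / 2 satisfies (1 - b)^2 = 1 - x, so it yields a
   square root of 1 - x without adjoining a unit to M. *)
Fixpoint sqrt_iter x (n : nat) : M :=
  if n is m.+1 then 2^-1 *: (x + amul (sqrt_iter x m) (sqrt_iter x m)) else 0.

(** The size predicate [Bd] is abstract because the iteration runs with two sizes, the norm of M and
    the operator bound in a faithful representation, before these are known to agree. The bound r
    persists since (r^2 + r^2) / 2 <= r, and successive differences shrink by (r + r) / 2. *)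
Lemma sqrt_iter_bound (Bd : R -> M -> Prop) x (r : R) :
  Bd 0 0 ->
  (forall s t a b, Bd s a -> Bd t b -> Bd (s + t) (a + b)) ->
  (forall s t a b, Bd s a -> Bd t b -> Bd (s * t) (amul a b)) ->
  (forall s a, Bd s a -> Bd (s / 2) (2^-1 *: a)) ->
  (forall s t a, s <= t -> Bd s a -> Bd t a) ->
  0 <= r < 1 -> Bd (r ^+ 2) x ->
  forall n, Bd r (sqrt_iter x n) /\ Bd (r ^+ n) (sqrt_iter x n.+1 - sqrt_iter x n).
Proof.
move=> B0 BD BM BZ Ble /andP[r0 r1] Bx.
have Br n : Bd r (sqrt_iter x n).
  elim: n => [|n IH] /=; first exact: Ble B0.
  by apply: Ble (BZ _ _ (BD _ _ _ _ Bx (BM _ _ _ _ IH IH))); nra.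
move=> n; split=> //; elim: n => [|n IH].
  rewrite /= subr0 amul0l addr0; apply: Ble (BZ _ _ Bx); rewrite expr0; nra.
have -> : sqrt_iter x n.+2 - sqrt_iter x n.+1 = 2^-1 *:
    (amul (sqrt_iter x n.+1) (sqrt_iter x n.+1 - sqrt_iter x n) +
     amul (sqrt_iter x n.+1 - sqrt_iter x n) (sqrt_iter x n)).
  rewrite amulBr amulBl addrA subrK.
  rewrite [sqrt_iter x n.+2]/= -/(sqrt_iter x n.+1) {2}[sqrt_iter x n.+1]/=.
  by rewrite -scalerBr opprD addrACA subrr add0r.
apply: Ble (BZ _ _ (BD _ _ _ _ (BM _ _ _ _ (Br n.+1) IH) (BM _ _ _ _ IH (Br n)))).
rewrite exprS [_ ^+ n * r]mulrC; lra.
Qed.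

Lemma sqrt_iter_star x n : astar x = x -> astar (sqrt_iter x n) = sqrt_iter x n.
Proof.
move=> xs; elim: n => [|n IH] /=; first exact: astar0.
rewrite astarZ astarD xs astarM IH; congr (_ *: _).
by rewrite fmorphV rmorph_nat.
Qed.

Lemma sqrt_iter_comm x s n : amul x s = amul s x ->
  amul (sqrt_iter x n) s = amul s (sqrt_iter x n).
Proof.
move=> xs; elim: n => [|n IH] /=; first by rewrite amul0l amul0r.
by rewrite amulZl amulZr amulDl amulDr xs -amulA IH !amulA IH.
Qed.

Section Representation.
Variables (H : hilbert R) (pi : M -> H -> H).
Hypothesis hpi : cstar_rep pi.

Lemma repD a b h : pi (a + b) h = pi a h + pi b h.
Proof. by have := rep_linear hpi 1 a b h; rewrite !scale1r. Qed.

Lemma lin_rep h : linear (fun a => pi a h).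
Proof. by move=> k a b; exact: rep_linear hpi _ _ _ _. Qed.

Lemma repZ k a h : pi (k *: a) h = k *: pi a h.
Proof. exact: linZ (lin_rep h) _ _. Qed.

Lemma repB a b h : pi (a - b) h = pi a h - pi b h.
Proof. exact: linB (lin_rep h) _ _. Qed.

Lemma rep0 h : pi 0 h = 0.
Proof. exact: lin0 (lin_rep h). Qed.

Lemma lin_repr a : linear (pi a).
Proof. by case: (rep_bounded hpi a). Qed.

Lemma rep_starl a h k : hip (pi (astar a) h) k = hip h (pi a k).
Proof. by rewrite (rep_star hpi) astarK. Qed.

Lemma rep_normsq a h : rn (pi a h) ^+ 2 = complex.Re (hip h (pi (amul (astar a) a) h)).
Proof. by rewrite rn_hip (rep_star hpi) (rep_mul hpi). Qed.

(* With (1 - b)^2 = 1 - a^* a, one has |h|^2 - |pi a h|^2 = |h - pi b h|^2. *)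
Lemma rep_contractive a h : rn (pi a h) <= rn a * rn h.
Proof.
suff small b : rn b < 1 -> rn (pi b h) <= rn h.
  rewrite -subr_le0; apply: (@eps_le0M _ _ (rn h)) => e e0.
  have t0 : 0 < rn a + e by rewrite ltr_wpDl ?rn_ge0.
  have i0 : 0 <= (rn a + e)^-1 by rewrite invr_ge0 ltW.
  have := small ((rn a + e)^-1%:C *: a).
  rewrite rnZ rn_real (ger0_norm i0) mulrC ltr_pdivrMr // mul1r ltrDl.
  move/(_ e0); rewrite repZ rnZ rn_real (ger0_norm i0).
  by rewrite mulrC ler_pdivrMr //; lra.
move=> b1; pose x := amul (astar b) b.
have xs : astar x = x by rewrite /x astarM astarK.
have rb := rn_ge0 b.
have bnd := @sqrt_iter_bound (fun s c => rn c <= s) x (rn b).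
have {bnd} bnd n : rn (sqrt_iter x n) <= rn b /\
    rn (sqrt_iter x n.+1 - sqrt_iter x n) <= rn b ^+ n.
  apply: bnd => //.
  - by rewrite rn0.
  - by move=> s t c d hs ht; apply: le_trans (rnD _ _) _; rewrite lerD.
  - move=> s t c d hs ht; apply: le_trans (rn_amul _ _) _.
    by rewrite ler_pM ?rn_ge0.
  - move=> s c hs; rewrite rnZ.
    have -> : (2^-1 : C) = (2^-1 : R)%:C by rewrite fmorphV rmorph_nat.
    by rewrite rn_real ger0_norm ?invr_ge0 // mulrC ler_wpM2r ?invr_ge0.
  - by move=> s t c st hs; exact: le_trans st.
  - by rewrite rb.
  - by rewrite rn_astar_mul.
have [c uc] : exists c, tends (sqrt_iter x) c.
  apply: (@geometric_tends _ _ _ 1 (rn b)); first by rewrite rb.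
  by move=> n; rewrite mul1r; exact: (bnd n).2.
have cs : astar c = c.
  apply: (tends_unique _ uc); apply: (@tends_lip _ _ _ _ _ _ _ 1 uc) => n.
  by rewrite -{1}(sqrt_iter_star n xs) -astarB rn_astar mul1r.
have cc : 2 *: c = x + amul c c.
  apply: (@tends_unique _ _ (fun n => 2 *: sqrt_iter x n.+1)).
    exact/tendsZ/tends_shift.
  apply: (@tends_lip _ _ _ _ _ _ _ (rn b + rn c) uc) => n /=.
  rewrite scalerA divff ?pnatr_eq0 // scale1r opprD addrACA subrr add0r.
  have -> : amul (sqrt_iter x n) (sqrt_iter x n) - amul c c =
      amul (sqrt_iter x n) (sqrt_iter x n - c) + amul (sqrt_iter x n - c) c.
    by rewrite amulBr amulBl addrA subrK.
  apply: le_trans (rnD _ _) _.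
  apply: le_trans (lerD (rn_amul _ _) (rn_amul _ _)) _.
  by rewrite mulrDl [_ * rn c]mulrC lerD2r ler_wpM2r ?rn_ge0 // (bnd n).1.
rewrite -(ler_pXn2r (n := 2)) ?nnegrE ?rn_ge0 // rep_normsq -/x.
have := sqr_ge0 (rn (h - pi c h)); rewrite rn_sqrB rep_normsq cs.
have -> : amul c c = 2 *: c - x by rewrite cc addrC addKr.
rewrite repB repZ hipBr hipZr raddfB /=.
have -> : complex.Re (2 * hip h (pi c h)) = 2 * complex.Re (hip h (pi c h)).
  by rewrite !mulr_natl raddfMn.
lra.
Qed.

End Representation.
End Algebra.

(** * Von Neumann algebras: strong limits and the operator norm *)

Section VonNeumann.
Variable R : realType.
Local Notation C := R[i].
Variables (M : cstar_algebra R) (V : von_neumann M).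
Implicit Types a b c x : M.
Local Notation rho := (@vrep R M V).
Let hrho : cstar_rep rho := vrep_rep V.

Lemma vrep_eq a b : (forall h, rho a h = rho b h) -> a = b.
Proof. by move=> h; apply: (@vrep_inj _ _ V); exact/funext. Qed.

(** A strong limit of represented elements commutes with their commutant, so the bicommutant
    condition puts it back in the range. *)
Lemma vrep_strong_limit (u : nat -> M) (c : R) :
  (forall n h, rn (rho (u n) h) <= c * rn h) ->
  (forall h, exists l, tends (fun n => rho (u n) h) l) ->
  exists a, forall h, tends (fun n => rho (u n) h) (rho a h).
Proof.
move=> hc /choice[B hB].
suff [a _ ha] : range rho B by exists a => h; rewrite ha.
rewrite -(vrep_bicommutant V); split.
  apply/bounded_rn; split=> [k x y|].
    apply: (tends_unique (hB _)).
    have := tendsD (tendsZ k (hB x)) (hB y); apply: tends_ext => n.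
    by rewrite (lin_repr hrho).
  exists `|c| => // x; apply: (tends_rn_le (hB x)); exists 0%N => n _.
  by apply: le_trans (hc n x) _; rewrite ler_wpM2r ?rn_ge0 // ler_norm.
move=> A [bA hA] h; apply: (@tends_unique _ _ (fun n => rho (u n) (A h)) _ _ _ (hB _)).
have := bounded_tends bA (hB h); apply: tends_ext => n.
by rewrite (hA (rho (u n))) //; exists (u n).
Qed.

(* If (1 - b)^2 + s^2 = 1 with b and s commuting and self-adjoint, then 1 - b + is
   and 1 - b - is are formally unitary, so s has norm at most 1. *)
Lemma commuting_square_sum_norm s b : astar s = s -> astar b = b ->
  amul b s = amul s b -> 2 *: b = amul s s + amul b b -> rn s <= 1.
Proof.
move=> ss bs cm eq.
(* p + i q is s (1 - b + i s): the factor s keeps the formal unitary inside M, which may lack a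
   unit. *)
pose p := s - amul s b; pose q := amul s s.
have ps : astar p = p by rewrite astarB astarM ss bs cm.
have qs : astar q = q by rewrite astarM ss.
have pq : amul p q = amul q p.
  by rewrite /p /q amulBr amulBl !amulA -(amulA s b s) cm amulA -(amulA _ b s) cm !amulA.
have pp : amul p p + amul q q = q.
  have -> : amul p p = q - amul s (amul s (amul s s)).
    have -> : amul s s = 2 *: b - amul b b by rewrite eq addrK.
    rewrite /p amulBl !amulBr -(amulA s b s) cm.
    have -> : amul (amul s b) (amul s b) = amul s (amul s (amul b b)).
      by rewrite -!amulA; congr (amul s _); rewrite amulA cm -amulA.
    rewrite amulZr scaler_nat mulr2n amulDr !opprB opprD -/q -addrA.
    by congr (_ + _); rewrite addrCA.
  by rewrite /q -!amulA subrK.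
have qE : q = amul s s by [].
clearbody p q.
have nrm k : Num.conj k = - k -> k * k = -1 -> rn (p + k *: q) = rn s.
  move=> kc kk; apply/eqP.
  rewrite -(eqrXn2 (n := 2)) ?rn_ge0 //.
  rewrite -(rn_astar (p + k *: q)) -rn_astar_mul astarK astarD astarZ ps qs kc.
  rewrite amulDl !amulDr !amulZl !amulZr scalerA mulrN kk opprK scale1r pq.
  rewrite addrACA -addrA [X in _ + X]addrA scaleNr subrr add0r.
  by rewrite pp qE -{1}ss rn_astar_mul.
have n1 := nrm 'i%R (conjCi C) (ltac:(by rewrite -expr2 sqrCi)).
have n2 := nrm (- 'i%R) (ltac:(by rewrite rmorphN /= conjCi))
  (ltac:(by rewrite mulrNN -expr2 sqrCi)).
(* Two elements of norm |s| differ by 2 i q, so 2 |s|^2 <= 2 |s|. *)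
have : rn (p + 'i%R *: q - (p + - 'i%R *: q)) <= rn s + rn s.
  by apply: le_trans (rnB _ _) _; rewrite n1 n2.
rewrite opprD addrACA subrr add0r scaleNr opprK -mulr2n -scaler_nat !rnZ.
have -> : rn ('i%R : C) = 1 by rewrite /rn normCi.
have -> : rn (2 : C) = 2 by rewrite -[2](rmorph_nat (real_complex R)) rn_real ger0_norm.
rewrite mul1r qE -{1}ss rn_astar_mul.
have := rn_ge0 s; nra.
Qed.

(** With s = b^* b, the iteration for the square root of 1 - s^2 is controlled by operator bounds
    only, so it converges strongly; its limit is in M, and [commuting_square_sum_norm] turns it into
    a bound on the norm of s. *)
Lemma vrep_norm_le a (c : R) : 0 <= c -> (forall h, rn (rho a h) <= c * rn h) -> rn a <= c.
Proof.
suff small b r : 0 <= r < 1 -> (forall h, rn (rho b h) <= r * rn h) -> rn b <= 1.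
  move=> c0 hc; rewrite -subr_le0; apply: eps_le0 => e e0.
  have t0 : 0 < c + e by rewrite ltr_wpDl.
  have i0 : 0 <= (c + e)^-1 by rewrite invr_ge0 ltW.
  have := @small ((c + e)^-1%:C *: a) (c / (c + e)).
  rewrite rnZ rn_real (ger0_norm i0) [_^-1 * rn a]mulrC ler_pdivrMr // mul1r => H.
  rewrite lerBlDr addrC; apply: H.
    by apply/andP; split; [apply: divr_ge0 => //; exact: ltW | rewrite ltr_pdivrMr // mul1r ltrDl].
  move=> h; rewrite (repZ hrho) rnZ rn_real (ger0_norm i0).
  by rewrite mulrAC mulrC ler_wpM2r.
move=> /andP[r0 r1] hb.
have hbs h : rn (rho (astar b) h) <= r * rn h.
  have [->|z0] := eqVneq (rn (rho (astar b) h)) 0; first by rewrite mulr_ge0 ?rn_ge0.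
  have zp : 0 < rn (rho (astar b) h) by rewrite lt_def z0 rn_ge0.
  rewrite -(ler_pM2r zp) -expr2 rn_hip (rep_starl hrho).
  apply: le_trans (Re_le_rn _) _; apply: le_trans (cauchy_schwarz _ _) _.
  by rewrite [r * rn h]mulrC -mulrA ler_wpM2l ?rn_ge0.
pose s := amul (astar b) b.
have ss : astar s = s by rewrite /s astarM astarK.
pose x := amul s s; have xs : astar x = x by rewrite /x astarM ss.
pose Bd t c := 0 <= t /\ forall h, rn (rho c h) <= t * rn h.
have BM t t' d c' : Bd t d -> Bd t' c' -> Bd (t * t') (amul d c').
  move=> [t0 hc] [t'0 hc']; split=> [|h]; first by rewrite mulr_ge0.
  by rewrite (rep_mul hrho); apply: le_trans (hc _) _; rewrite -mulrA ler_wpM2l.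
have r2 : 0 <= r ^+ 2 < 1 by rewrite sqr_ge0 /=; nra.
have bnd n : Bd (r ^+ 2) (sqrt_iter x n) /\
    Bd ((r ^+ 2) ^+ n) (sqrt_iter x n.+1 - sqrt_iter x n).
  apply: sqrt_iter_bound => //.
  - by split=> // h; rewrite (rep0 hrho) rn0 mul0r.
  - move=> t t' d c' [t0 hc] [t'0 hc']; split=> [|h]; first by rewrite addr_ge0.
    by rewrite (repD hrho); apply: le_trans (rnD _ _) _; rewrite mulrDl lerD.
  - move=> t d [t0 hc]; split=> [|h]; first by rewrite divr_ge0.
    rewrite (repZ hrho) rnZ.
    have -> : (2^-1 : C) = (2^-1 : R)%:C by rewrite fmorphV rmorph_nat.
    by rewrite rn_real ger0_norm ?invr_ge0 // mulrAC mulrC ler_wpM2r ?invr_ge0.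
  - move=> t t' d tt [t0 hc]; split=> [|h]; first exact: le_trans tt.
    by apply: le_trans (hc h) _; rewrite ler_wpM2r ?rn_ge0.
  - have hs : Bd (r ^+ 2) s by rewrite expr2; apply: BM; split.
    by rewrite [X in Bd X]expr2; exact: BM.
have [d hd] : exists d, forall h, tends (fun n => rho (sqrt_iter x n) h) (rho d h).
  apply: (@vrep_strong_limit _ (r ^+ 2)) => [n h|h]; first exact: (bnd n).1.2.
  apply: (@geometric_tends _ _ _ (rn h) (r ^+ 2)) => // n.
  by rewrite -(repB hrho) mulrC; exact: (bnd n).2.2.
have cs : astar d = d.
  apply: vrep_eq => h; apply: hip_ext => k.
  rewrite -(rep_star hrho); apply: (tends_unique (hip_liml h (hd k))).
  apply: tends_ext (hip_lim k (hd h)) => n.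
  by rewrite (rep_star hrho) sqrt_iter_star.
have cm : amul d s = amul s d.
  apply: vrep_eq => h; rewrite (rep_mul hrho d s) (rep_mul hrho s d).
  apply: (tends_unique (hd (rho s h))).
  apply: tends_ext (bounded_tends (rep_bounded hrho s) (hd h)) => n /=.
  by rewrite -!(rep_mul hrho) sqrt_iter_comm // /x amulA.
have cc : 2 *: d = x + amul d d.
  apply: vrep_eq => h; rewrite (repZ hrho) (repD hrho) (rep_mul hrho).
  apply: (tends_unique (tendsZ 2 (tends_shift (hd h)))).
  have : tends (fun n => rho x h + rho (sqrt_iter x n) (rho (sqrt_iter x n) h))
      (rho x h + rho d (rho d h)).
    apply: tendsD; first exact: tends_cst.
    have : tends (fun n => rho (sqrt_iter x n) (rho (sqrt_iter x n) h - rho d h)) 0.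
      apply: (@tends_lip _ _ _ _ _ _ _ (r ^+ 2) (hd h)) => n.
      by rewrite subr0; exact: (bnd n).1.2.
    move=> /tendsD/(_ (hd (rho d h))); rewrite add0r; apply: tends_ext => n.
    by rewrite (linB (lin_repr hrho _)) subrK.
  apply: tends_ext => n; rewrite /= (repZ hrho) scalerA divff ?pnatr_eq0 // scale1r.
  by rewrite (repD hrho) (rep_mul hrho).
have := commuting_square_sum_norm ss cs cm cc.
by rewrite rn_astar_mul => h; rewrite -(ler_pXn2r (n := 2)) ?nnegrE ?rn_ge0 // expr1n.
Qed.

End VonNeumann.

(** * Hilbert modules *)

Section Modules.
Variable R : realType.
Local Notation C := R[i].
Variable M : cstar_algebra R.
Variable F : correspondence M.
Implicit Types (x y z : F) (a b : M).

Lemma lin_cip x : linear (cip x).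
Proof. by move=> k y z; exact: cip_linear. Qed.

Lemma cipDr x y z : cip x (y + z) = cip x y + cip x z.
Proof. exact: linD (lin_cip x) _ _. Qed.
Lemma cipBr x y z : cip x (y - z) = cip x y - cip x z.
Proof. exact: linB (lin_cip x) _ _. Qed.
Lemma cipZr x (k : C) y : cip x (k *: y) = k *: cip x y.
Proof. exact: linZ (lin_cip x) _ _. Qed.
Lemma cip0r x : cip x 0 = 0.
Proof. exact: lin0 (lin_cip x). Qed.

Lemma cipDl x y z : cip (x + y) z = cip x z + cip y z.
Proof. by rewrite cip_star cipDr astarD -!cip_star. Qed.
Lemma cipBl x y z : cip (x - y) z = cip x z - cip y z.
Proof. by rewrite cip_star cipBr astarB -!cip_star. Qed.
Lemma cipZl (k : C) x y : cip (k *: x) y = Num.conj k *: cip x y.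
Proof. by rewrite cip_star cipZr astarZ -cip_star. Qed.
Lemma cip0l x : cip 0 x = 0.
Proof. by rewrite cip_star cip0r astar0. Qed.

Lemma cip_ractl x a y : cip (ract x a) y = amul (astar a) (cip x y).
Proof. by rewrite cip_star cip_ract astarM -cip_star. Qed.

Lemma rn_cip_self x : rn (cip x x) = rn x ^+ 2.
Proof. by have := cip_norm x; rewrite !rnE -rmorphXn => /complexI. Qed.

Lemma cip_eq0 x : cip x x = 0 -> x = 0.
Proof.
move=> h; apply: rn_eq0; apply/eqP.
by have := rn_cip_self x; rewrite h rn0 => /esym/eqP; rewrite sqrf_eq0.
Qed.

Lemma cip_ext x y : (forall z, cip z x = cip z y) -> x = y.
Proof.
move=> h; apply/eqP; rewrite -subr_eq0; apply/eqP/cip_eq0.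
by rewrite cipBr h subrr.
Qed.

(* Polarization; the sharp constant 1 would need more of the theory of positive
   elements of M. *)
Lemma rn_cip x y : rn (cip x y) <= 4 * (rn x * rn y).
Proof.
have pol (u v : F) : rn (cip u v) <= (rn u + rn v) ^+ 2.
  have nrm (k : C) : rn k = 1 -> rn (cip (u + k *: v) (u + k *: v)) <= (rn u + rn v) ^+ 2.
    move=> k1; rewrite rn_cip_self ler_pXn2r ?nnegrE ?rn_ge0 ?addr_ge0 ?rn_ge0 //.
    by apply: le_trans (rnD _ _) _; rewrite rnZ k1 mul1r.
  have n1 : rn (1 : C) = 1 by rewrite -[1](rmorph1 (real_complex R)) rn_real normr1.
  have ni : rn ('i%R : C) = 1 by rewrite /rn normCi.
  have h1 := nrm 1 n1; have h2 := nrm (-1) (ltac:(by rewrite rnN)).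
  have h3 := nrm 'i%R ni; have h4 := nrm (-'i%R) (ltac:(by rewrite rnN)).
  set A := cip u v; set B := cip v u; set S := cip u u + cip v v.
  have ex (k : C) : Num.conj k * k = 1 ->
      cip (u + k *: v) (u + k *: v) = S + (k *: A + Num.conj k *: B).
    move=> kk; rewrite cipDl !cipDr !cipZl !cipZr scalerA kk scale1r -/A -/B.
    by rewrite [_ *: B + _]addrC addrACA.
  have n2 : rn (2 : C) = 2.
    by rewrite -[2](rmorph_nat (real_complex R)) rn_real ger0_norm.
  have dif (k : C) : Num.conj k * k = 1 ->
      cip (u + k *: v) (u + k *: v) - cip (u + - k *: v) (u + - k *: v) =
      2 *: (k *: A + Num.conj k *: B).
    move=> kk; rewrite !ex ?rmorphN ?mulrNN //= opprD addrACA subrr add0r.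
    by rewrite !scaleNr -opprD opprK -mulr2n scaler_nat.
  have d1 : rn (A + B) <= (rn u + rn v) ^+ 2.
    have := dif 1 (ltac:(by rewrite rmorph1 mulr1)).
    rewrite rmorph1 !scale1r => /(congr1 (@rn R _)); rewrite rnZ n2 => e.
    have := rnB (cip (u + v) (u + v)) (cip (u + -1 *: v) (u + -1 *: v)).
    by move: h1; rewrite !scale1r; lra.
  have d2 : rn (A - B) <= (rn u + rn v) ^+ 2.
    have := dif 'i%R (ltac:(by rewrite conjCi mulNr -expr2 sqrCi opprK)).
    rewrite conjCi [- _ *: B]scaleNr -scalerBr => /(congr1 (@rn R _)).
    rewrite rnZ n2 rnZ ni mul1r => e.
    have := rnB (cip (u + 'i%R *: v) (u + 'i%R *: v))
      (cip (u + -'i%R *: v) (u + -'i%R *: v)).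
    by lra.
  have := rnD (A + B) (A - B).
  by rewrite addrACA subrr addr0 -mulr2n -scaler_nat rnZ n2; lra.
have [x0|x0] := eqVneq (rn x) 0.
  by rewrite (rn_eq0 x0) cip0l !rn0 mul0r mulr0.
have [y0|y0] := eqVneq (rn y) 0.
  by rewrite (rn_eq0 y0) cip0r !rn0 !mulr0.
have xp : 0 < rn x by rewrite lt_def x0 rn_ge0.
have yp : 0 < rn y by rewrite lt_def y0 rn_ge0.
have xi : 0 <= (rn x)^-1 by rewrite invr_ge0 ltW.
have yi : 0 <= (rn y)^-1 by rewrite invr_ge0 ltW.
(* On unit vectors the polarization bound is (1 + 1)^2, the source of the factor 4. *)
have := pol ((rn x)^-1%:C *: x) ((rn y)^-1%:C *: y).
rewrite cipZl cipZr !rnZ rn_conj !rn_real !ger0_norm // !mulVf //.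
rewrite mulrA -invfM mulrC ler_pdivrMr ?mulr_gt0 //; lra.
Qed.

Lemma rn_ract x a : rn (ract x a) <= rn x * rn a.
Proof.
rewrite -(ler_pXn2r (n := 2)) ?nnegrE ?mulr_ge0 ?rn_ge0 //.
rewrite -rn_cip_self cip_ract cip_ractl; apply: le_trans (rn_amul _ _) _.
rewrite exprMn expr2 [_ ^+ 2 in leRHS]expr2 mulrA ler_wpM2r ?rn_ge0 //.
by apply: le_trans (rn_amul _ _) _; rewrite rn_astar rn_cip_self mulrC expr2.
Qed.

Lemma cadjoint_sym (A B : F -> F) : is_cadjoint A B -> is_cadjoint B A.
Proof. by move=> h x y; rewrite cip_star -h -cip_star. Qed.

Lemma cadjoint_bound (A B : F -> F) (c : R) : is_cadjoint A B -> 0 <= c ->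
  (forall x, rn (A x) <= c * rn x) -> forall x, rn (B x) <= 4 * c * rn x.
Proof.
move=> h c0 hc x.
have [->|b0] := eqVneq (rn (B x)) 0; first by rewrite !mulr_ge0 ?rn_ge0.
have bp : 0 < rn (B x) by rewrite lt_def b0 rn_ge0.
rewrite -(ler_pM2r bp) -expr2 -rn_cip_self -h; apply: le_trans (rn_cip _ _) _.
by have := hc (B x); have := rn_ge0 x; nra.
Qed.

Section Representation.
Variables (H : hilbert R) (pi : M -> H -> H).
Hypothesis hpi : cstar_rep pi.

(** The squared norm of x (x) h in the tensor product of F and H over pi, expressed without that
    space. *)
Definition qf (h : H) x : R := complex.Re (hip h (pi (cip x x) h)).

Lemma qfE h x : hip h (pi (cip x x) h) = (qf h x)%:C.
Proof.
rewrite /qf; have [b ->] := cip_ge0 x.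
by rewrite (rep_mul hpi) -(rep_star hpi) hip_self.
Qed.

Lemma qf_ge0 h x : 0 <= qf h x.
Proof.
rewrite /qf; have [b ->] := cip_ge0 x.
by rewrite (rep_mul hpi) -(rep_star hpi) hip_self sqr_ge0.
Qed.

Lemma qfN h x : qf h (- x) = qf h x.
Proof. by rewrite /qf -scaleN1r cipZl cipZr scalerA rmorphN1 mulrNN mulr1 scale1r. Qed.

Lemma qf_par h x y : qf h (x + y) + qf h (x - y) = 2 * qf h x + 2 * qf h y.
Proof.
have e : cip (x + y) (x + y) + cip (x - y) (x - y) =
    (cip x x + cip x x) + (cip y y + cip y y).
  rewrite [cip (x - y) _]cipBl !cipBr [cip (x + y) _]cipDl !cipDr.
  move: (cip x x) (cip x y) (cip y x) (cip y y) => a b c d.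
  have -> : a + b + (c + d) = a + d + (b + c) by rewrite [c + d]addrC addrACA.
  have -> : a - b - (c - d) = a + d - (b + c) by rewrite opprB addrACA -opprD.
  by rewrite addrACA subrr addr0 addrACA.
rewrite /qf -raddfD -hipDr -(repD hpi) e !(repD hpi) !hipDr !raddfD /=; ring.
Qed.

Lemma qf_le h x : qf h x <= rn x ^+ 2 * rn h ^+ 2.
Proof.
apply: le_trans (Re_le_rn _) _; apply: le_trans (cauchy_schwarz _ _) _.
rewrite mulrC [rn h ^+ 2]expr2 mulrA ler_wpM2r ?rn_ge0 //.
by rewrite -rn_cip_self; exact: rep_contractive.
Qed.

(* The form <y - t x a, y - t x a> with a = <x, y> is positive for all real t. *)
Lemma rep_cip_le x y h : rn (pi (cip x y) h) ^+ 2 <= rn x ^+ 2 * qf h y.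
Proof.
have [x0|x0] := eqVneq (rn x) 0.
  by rewrite (rn_eq0 x0) cip0l (rep0 hpi) !rn0 expr0n /= mul0r.
have xp : 0 < rn x ^+ 2 by rewrite exprn_gt0 // lt_def x0 rn_ge0.
set a := cip x y; set X := rn x ^+ 2 in xp *.
have e (t : R) : qf h (y - t%:C *: ract x a) =
    qf h y - 2 * t * rn (pi a h) ^+ 2 + t ^+ 2 * qf (pi a h) x.
  have tc : Num.conj t%:C = t%:C :> C by apply/CrealP; rewrite complex_real.
  have key : cip (y - t%:C *: ract x a) (y - t%:C *: ract x a) = cip y y -
      t%:C *: amul (astar a) a - (t%:C *: amul (astar a) a -
        (t * t)%:C *: amul (amul (astar a) (cip x x)) a).
    rewrite cipBl !cipBr !cipZl !cipZr !cip_ract !cip_ractl tc scalerA -rmorphM.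
    by rewrite (cip_star x y).
  apply: complexI; rewrite -qfE key !(repB hpi) !(repZ hpi) !hipBr !hipZr.
  rewrite !(rep_mul hpi) -!(rep_star hpi) hip_self !qfE.
  rewrite !rmorphD !rmorphN !rmorphM /= ?rmorphXn; ring.
have := qf_ge0 h (y - X^-1%:C *: ract x a); rewrite e => H1.
have := qf_le (pi a h) x; rewrite -/X => H2.
have : 0 <= qf h y - X^-1 * rn (pi a h) ^+ 2.
  have : X^-1 ^+ 2 * qf (pi a h) x <= X^-1 ^+ 2 * (X * rn (pi a h) ^+ 2).
    by rewrite ler_wpM2l ?sqr_ge0.
  have -> : X^-1 ^+ 2 * (X * rn (pi a h) ^+ 2) = X^-1 * rn (pi a h) ^+ 2.
    by field; rewrite gt_eqF.
  lra.
by rewrite subr_ge0 ler_pdivrMl.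
Qed.

Lemma hip_rep_cip_le x y h k :
  rn (hip k (pi (cip x y) h)) ^+ 2 <= rn k ^+ 2 * rn x ^+ 2 * qf h y.
Proof.
have := cauchy_schwarz k (pi (cip x y) h) => cs.
apply: (@le_trans _ _ ((rn k * rn (pi (cip x y) h)) ^+ 2)).
  by rewrite ler_pXn2r ?nnegrE ?mulr_ge0 ?rn_ge0.
by rewrite exprMn -mulrA ler_wpM2l ?sqr_ge0 // rep_cip_le.
Qed.

End Representation.
End Modules.

Section Isometries.
Variable R : realType.
Local Notation C := R[i].
Variables (M : cstar_algebra R) (F G : correspondence M) (i : F -> G).
Hypothesis hi : bimodule_isometry i.

Lemma rn_bi x : rn (i x) = rn x.
Proof.
apply/eqP; rewrite -(eqrXn2 (n := 2)) ?rn_ge0 //.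
by rewrite -!rn_cip_self (bi_ip hi).
Qed.

End Isometries.

(** * Ampliations and the Toeplitz algebra *)

Section BoundedExtension.
Variable R : realType.
Local Notation C := R[i].

(** The map is given by its graph because an element of the dense domain may be presented in many
    ways; single-valuedness follows from the bound applied to a difference. *)
Lemma bounded_extension (V : normedModType C) (W : completeNormedModType C)
    (G : V -> W -> Prop) (c : R) :
  G 0 0 ->
  (forall k v w v' w', G v w -> G v' w' -> G (k *: v + v') (k *: w + w')) ->
  (forall v w, G v w -> rn w <= c * rn v) ->
  closure [set v | exists w, G v w] = setT ->
  exists f : V -> W, bounded_op f /\ forall v w, G v w -> f v = w.
Proof.
move=> G0 GD Gc dG.
pose L v l := exists u w, [/\ forall n, G (u n) (w n), tends u v & tends w l].
have Lc v l : L v l -> rn l <= `|c| * rn v.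
  move=> [u [w [Gu uv wl]]].
  rewrite -subr_le0; apply: (@eps_le0M _ _ (`|c| + 1)) => e e0.
  have [N hN] := uv e e0; have [N' hN'] := wl e e0.
  set n := maxn N N'.
  have := hN n (leq_maxl _ _); have := hN' n (leq_maxr _ _).
  have := rn_tri l (w n) 0; have := rn_tri (u n) v 0; rewrite !subr0 (rnBC l (w n)).
  have := Gc _ _ (Gu n).
  have : c * rn (u n) <= `|c| * rn (u n) by rewrite ler_wpM2r ?rn_ge0 // ler_norm.
  have : 0 <= `|c| by [].
  nra.
have LD k v l v' l' : L v l -> L v' l' -> L (k *: v + v') (k *: l + l').
  move=> [u [w [Gu uv wl]]] [u' [w' [Gu' uv' wl']]].
  exists (fun n => k *: u n + u' n), (fun n => k *: w n + w' n); split.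
  - by move=> n; exact: GD.
  - by apply: tendsD => //; exact: tendsZ.
  - by apply: tendsD => //; exact: tendsZ.
have Lu v l l' : L v l -> L v l' -> l = l'.
  move=> h h'; apply/eqP; rewrite -subr_eq0; apply/eqP/rn_le0.
  have := Lc _ _ (LD (-1) _ _ _ _ h' h).
  by rewrite !scaleN1r addNr rn0 mulr0 addrC.
have /choice[f hf] v : exists l, L v l.
  have : closure [set v | exists w, G v w] v by rewrite dG.
  move=> /closure_seq[u /choice[w Gw] uv].
  have [l wl] : exists l, tends w l.
    apply: cauchy_tends => e e0.
    have c1 : 0 < 2 * (`|c| + 1) by rewrite mulr_gt0 // ltr_wpDl.
    have [N hN] := uv _ (divr_gt0 e0 c1).
    exists N => m n /hN; rewrite ltr_pdivlMr // => hm /hN; rewrite ltr_pdivlMr // => hn.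
    have := GD (-1) _ _ _ _ (Gw n) (Gw m).
    rewrite !scaleN1r [- _ + _]addrC [- w n + _]addrC => /Gc.
    have : c * rn (u m - u n) <= `|c| * rn (u m - u n) by rewrite ler_wpM2r ?rn_ge0 // ler_norm.
    have : 0 <= `|c| by [].
    have := rn_tri (u m) v (u n); rewrite (rnBC v); move: hm hn.
    have := rn_ge0 (u m - v); have := rn_ge0 (u n - v); nra.
  by exists l, u, w.
have LG v w : G v w -> L v w.
  by move=> Gv; exists (fun=> v), (fun=> w); split=> //; exact: tends_cst.
exists f; split=> [|v w /LG]; last exact: Lu (hf v).
apply/bounded_rn; split=> [k x y|]; first exact: Lu (hf _) (LD _ _ _ _ _ (hf x) (hf y)).
by exists `|c| => // x; exact: Lc.
Qed.

Lemma bounded_eq_dense (V W : normedModType C) (f g : V -> W) (S : set V) :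
  bounded_op f -> bounded_op g -> closure (span S) = setT ->
  (forall x, S x -> f x = g x) -> f = g.
Proof.
move=> bf bg dS e; apply/funext => x.
have : closure (span S) x by rewrite dS.
move=> /closure_seq[u Su ux].
apply: (tends_unique (bounded_tends bf ux)).
apply: tends_ext (bounded_tends bg ux) => n.
apply/esym; move: (u n) (Su n); apply: span_ind => //.
have lf := proj1 bf; have lg := proj1 bg.
split=> [|k v w /= fv fw]; first by rewrite /= (lin0 lf) (lin0 lg).
by rewrite lf lg fv fw.
Qed.

(* The recursion b_k^2 <= N b_(2k) amplifies any excess of b_1 over N q doubly
   exponentially, against the exponential bound. *)
Lemma doubling_bound (b : nat -> R) (N C0 q : R) : 0 < q -> 0 <= N ->
  (forall k, 0 <= b k) -> (forall k, b k ^+ 2 <= N * b (k + k)%N) ->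
  (forall k, b k <= C0 * q ^+ k) -> b 1%N <= N * q.
Proof.
move=> q0 N0 b0 bb bC.
have [Nz|Nz] := eqVneq N 0.
  have := bb 1%N; rewrite Nz !mul0r => h; have := b0 1%N; nra.
have Np : 0 < N by rewrite lt_def Nz N0.
rewrite leNgt; apply/negP => h.
(* Normalized so that the recursion becomes f_n^2 <= f_(n+1), with f_0 > 1 under the negated
   claim. *)
pose f n := b (2 ^ n)%N / (N * q ^+ (2 ^ n)).
have Nq n : 0 < N * q ^+ n by rewrite mulr_gt0 ?exprn_gt0.
have ff n : f n ^+ 2 <= f n.+1.
  rewrite /f expnS mul2n -addnn expr_div_n exprMn.
  rewrite ler_pdivrMr ?mulr_gt0 ?exprn_gt0 //.
  apply: le_trans (bb _) _.
  rewrite exprD -mulrA le_eqVlt; apply/orP; left; apply/eqP; field.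
  by rewrite Nz andbT expf_neq0 // gt_eqF.
have f1 : 1 < f 0%N by rewrite /f expn0 expr1 ltr_pdivlMr ?mulr_gt0 // mul1r.
(* Linear growth, as in Bernoulli's inequality, already exceeds the constant bound C0 / N. *)
have fn k : 1 + k.+1%:R * (f 0%N - 1) <= f k.
  elim: k => [|k IH]; first by rewrite mul1r addrC subrK.
  apply: le_trans (ff k); rewrite -(natr1 k.+1).
  have : 1 <= k.+1%:R :> R by rewrite ler1n.
  move: (k.+1%:R : R) (f k) (f 0%N) f1 IH => m y z z1 my m1.
  have d0 : 0 < z - 1 by rewrite subr_gt0.
  have : z - 1 <= m * (z - 1) by rewrite ler_peMl // ltW.
  have : (1 + m * (z - 1)) ^+ 2 <= y ^+ 2.
    rewrite ler_pXn2r ?nnegrE //; nra.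
  nra.
have fC k : f k <= C0 / N.
  by rewrite /f ler_pdivrMr // mulrA mulfVK ?bC.
have d0 : 0 < f 0%N - 1 by rewrite subr_gt0.
set k := Num.truncn (C0 / N / (f 0%N - 1)).
have : C0 / N / (f 0%N - 1) < k.+1%:R by exact: truncnS_gt.
rewrite ltr_pdivrMr //; have := fC k; have := fn k; lra.
Qed.

End BoundedExtension.

Section Ampliation.
Variable R : realType.
Local Notation C := R[i].
Variables (M : cstar_algebra R) (F : correspondence M) (D : hilbert R).
Variables (pi : M -> D -> D) (hpi : cstar_rep pi) (K : hilbert_tensor F pi).
Local Notation t := (@ht_tens _ _ _ _ _ K).
Implicit Types (A B : F -> F) (rho : K -> K).

Lemma lin_htl d : linear (fun x => t x d).
Proof. exact: ht_linearl. Qed.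

Lemma rn_ht x d : rn (t x d) <= rn x * rn d.
Proof.
rewrite -(ler_pXn2r (n := 2)) ?nnegrE ?mulr_ge0 ?rn_ge0 // rn_hip ht_ip exprMn.
exact: qf_le.
Qed.

(** A (x) 1 evaluated on a formal sum of elementary tensors. The list is kept because [tsum_bound]
    is what shows that the result depends only on [tsum id s]. *)
Definition tsum A (s : seq (C * F * D)) : K := \sum_(p <- s) p.1.1 *: t (A p.1.2) p.2.

Lemma tsum_adjoint A B A' s s' : is_cadjoint A B ->
  hip (tsum A s) (tsum A' s') = hip (tsum id s) (tsum (fun x => B (A' x)) s').
Proof.
move=> h.
have one (x : F) (d : D) : hip (t (A x) d) (tsum A' s') =
    hip (t x d) (tsum (fun x => B (A' x)) s').
  rewrite /tsum; elim: s' => [|[[k' x'] d'] s' IH]; first by rewrite !big_nil !hip0r.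
  by rewrite !big_cons !hipDr !hipZr IH /= !ht_ip h.
elim: s => [|[[k x] d] s IH]; first by rewrite /tsum !big_nil !hip0l.
by rewrite {1 3}/tsum !big_cons !hipDl !hipZl IH one.
Qed.

(** The constant depends on the formal sum and not on its value in K; [doubling_bound] eliminates
    it. *)
Lemma tsum_iter_bound (Q : F -> F) (q : R) s : 0 <= q -> (forall x, rn (Q x) <= q * rn x) ->
  exists c, forall k, rn (tsum (iter k Q) s) <= c * q ^+ k.
Proof.
move=> q0 hQ.
have hk k x : rn (iter k Q x) <= q ^+ k * rn x.
  elim: k => [|k IH]; first by rewrite mul1r.
  by apply: le_trans (hQ _) _; rewrite exprS -mulrA ler_wpM2l.
elim: s => [|[[k x] d] s [c hc]].
  by exists 0 => k; rewrite /tsum big_nil rn0 mul0r.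
exists (rn k * (rn x * rn d) + c) => n; rewrite /tsum big_cons mulrDl.
apply: le_trans (rnD _ _) _; apply: lerD; last exact: hc.
rewrite rnZ /= -mulrA ler_wpM2l ?rn_ge0 //.
apply: le_trans (rn_ht _ _) _.
by rewrite mulrAC ler_wpM2r ?rn_ge0 // mulrC.
Qed.

(* |(A (x) 1) v|^2 = (v, (B A (x) 1) v), and iterating Cauchy-Schwarz on powers of
   B A bounds this by |B A| |v|^2 without any positivity argument in L(F). *)
Lemma tsum_bound A B (c c' : R) s : is_cadjoint A B -> 0 <= c -> 0 <= c' ->
  (forall x, rn (A x) <= c * rn x) -> (forall x, rn (B x) <= c' * rn x) ->
  rn (tsum A s) <= (c' * c + 1) * rn (tsum id s).
Proof.
move=> h c0 c'0 hA hB.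
(* The added 1 gives q >= 1, which yields both q > 0 and q <= q^2. *)
pose Q x := B (A x); set q := c' * c + 1.
have q1 : 1 <= q by rewrite /q lerDr mulr_ge0.
have hQ x : rn (Q x) <= q * rn x.
  apply: le_trans (hB _) _; have := hA x; have := rn_ge0 x; rewrite /q; nra.
have QQ : is_cadjoint Q Q.
  by move=> x y; rewrite /Q (cadjoint_sym h) h.
have Qk k : is_cadjoint (iter k Q) (iter k Q).
  by elim: k => // k IH x y; rewrite iterS QQ IH -iterSr.
have [d hd] := tsum_iter_bound s (le_trans ler01 q1) hQ.
have : rn (tsum (iter 1 Q) s) <= rn (tsum id s) * q.
  apply: (@doubling_bound _ (fun k => rn (tsum (iter k Q) s)) _ d) => //.
  - exact: lt_le_trans q1.
  - exact: rn_ge0.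
  - by move=> k; exact: rn_ge0.
  - move=> k; rewrite rn_hip (tsum_adjoint _ _ _ (Qk k)).
    apply: le_trans (Re_le_rn _) _; apply: le_trans (cauchy_schwarz _ _) _.
    have -> // : (fun x : F => iter k Q (iter k Q x)) = iter (k + k) Q.
    by apply: functional_extensionality_dep => x; rewrite iterD.
rewrite /= => h1.
rewrite -(ler_pXn2r (n := 2)) ?nnegrE ?mulr_ge0 ?rn_ge0 //; last by lra.
rewrite rn_hip (tsum_adjoint _ _ _ h).
apply: le_trans (Re_le_rn _) _; apply: le_trans (cauchy_schwarz _ _) _.
have := rn_ge0 (tsum id s); rewrite -/Q => n0.
apply: (@le_trans _ _ (rn (tsum id s) * (rn (tsum id s) * q))); first by rewrite ler_wpM2l.
by rewrite exprMn [rn _ * q]mulrC mulrCA -expr2 ler_wpM2r ?sqr_ge0 // expr2 ler_peMl //; lra.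
Qed.

Lemma tsum_cat A k s s' :
  tsum A ([seq (k * p.1.1, p.1.2, p.2) | p <- s] ++ s') = k *: tsum A s + tsum A s'.
Proof.
rewrite /tsum big_cat big_map /= scaler_sumr; congr (_ + _).
by apply: eq_bigr => p _; rewrite scalerA.
Qed.

Lemma tsum_dense A : closure [set v | exists w, exists s, v = tsum id s /\ w = tsum A s] = setT.
Proof.
apply/seteqP; split=> // v _.
have : closure (span [set z | exists x h, z = t x h]) v by rewrite ht_dense.
apply: closure_subset; apply: span_ind.
  split; first by exists 0, [::]; rewrite /tsum !big_nil.
  move=> k x y [_ [s [-> _]]] [_ [s' [-> _]]].
  by rewrite -tsum_cat; eexists; eexists; split.
move=> _ [x [d ->]]; exists (t (A x) d), [:: (1, x, d)].
by rewrite /tsum !big_seq1 !scale1r.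
Qed.

Lemma ampliation_exists A B (c c' : R) : is_cadjoint A B -> 0 <= c -> 0 <= c' ->
  (forall x, rn (A x) <= c * rn x) -> (forall x, rn (B x) <= c' * rn x) ->
  exists rho, is_ampliation A rho.
Proof.
move=> h c0 c'0 hA hB.
have [||||f [bf hf]] := @bounded_extension _ K K
  (fun v w => exists s, v = tsum id s /\ w = tsum A s) (c' * c + 1).
- by exists [::]; rewrite /tsum !big_nil.
- by move=> k _ _ _ _ [s [-> ->]] [s' [-> ->]]; rewrite -!tsum_cat; eexists; split.
- by move=> _ _ [s [-> ->]]; exact: tsum_bound.
- exact: tsum_dense.
exists f; split=> // x d; apply: hf; exists [:: (1, x, d)].
by rewrite /tsum !big_seq1 !scale1r.
Qed.

Lemma ampliation_unique A rho rho' :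
  is_ampliation A rho -> is_ampliation A rho' -> rho = rho'.
Proof.
move=> [b h] [b' h']; apply: (bounded_eq_dense b b' (ht_dense K)).
by move=> _ [x [d ->]]; rewrite h h'.
Qed.

Lemma ampliation_linear (k : C) A A' rho rho' : is_ampliation A rho -> is_ampliation A' rho' ->
  is_ampliation (fun x => k *: A x + A' x) (fun v => k *: rho v + rho' v).
Proof.
move=> [b h] [b' h']; split=> [|x d]; first exact: bounded_opD.
by rewrite h h' (lin_htl d).
Qed.

Lemma ampliation_comp A A' rho rho' : is_ampliation A rho -> is_ampliation A' rho' ->
  is_ampliation (fun x => A (A' x)) (fun v => rho (rho' v)).
Proof.
move=> [b h] [b' h']; split=> [|x d]; first exact: bounded_op_comp.
by rewrite h' h.
Qed.

Lemma ampliation_adjoint A B rho : is_cadjoint A B -> is_ampliation A rho ->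
  is_ampliation B (adj rho).
Proof.
move=> hAB [b h]; split=> [|x d]; first exact: adj_bounded.
apply/eqP; rewrite -subr_eq0; apply/eqP.
apply: (dense_total (ht_dense K)) => _ [x' [d' ->]].
by rewrite hipBr -hip_adjr // h !ht_ip hAB subrr.
Qed.

Lemma ampliable_subalgebra :
  cstar_subalgebra [set A | adjointable A /\ exists rho, is_ampliation (K := K) A rho].
Proof.
split.
- by move=> A [].
- split; first by exists (fun=> 0) => x y; rewrite cip0l cip0r.
  exists (fun=> 0); split=> [|x d]; first exact: bounded_op0.
  by rewrite (lin0 (lin_htl d)).
- move=> k a b [[a' ha] [r hr]] [[b' hb] [r' hr']]; split; last first.
    by eexists; exact: ampliation_linear hr hr'.
  exists (fun y => Num.conj k *: a' y + b' y) => x y.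
  by rewrite cipDl cipZl ha hb cipDr cipZr.
- move=> a b [[a' ha] [r hr]] [[b' hb] [r' hr']]; split; last first.
    by eexists; exact: ampliation_comp hr hr'.
  by exists (fun y => b' (a' y)) => x y; rewrite ha hb.
- move=> a b [_ [r hr]] hab; split; first by exists a; exact: cadjoint_sym.
  by eexists; exact: ampliation_adjoint hab hr.
- move=> a aa h; split=> //; have [a' ha] := aa.
  (* One approximant at distance 1 suffices: a - b is then bounded, as [ampliation_exists] demands,
     and a is the sum of two ampliable operators. *)
  have [b [[b' hb] [r hr]] hab] := h 1 ltr01.
  pose g x := a x - b x; pose g' x := a' x - b' x.
  have gg : is_cadjoint g g' by move=> x y; rewrite /g /g' cipBl cipBr ha hb.
  have g1 x : rn (g x) <= 1 * rn x.
    by have := hab x; rewrite !rnE -[1](rmorph1 (real_complex R)) -rmorphM lecR.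
  have [r' hr'] := ampliation_exists gg ler01 (mulr_ge0 (ler0n R 4) ler01) g1
    (cadjoint_bound gg ler01 g1).
  exists (fun v => 1 *: r' v + r v).
  have := ampliation_linear 1 hr' hr; congr (is_ampliation _ _); apply/funext => x.
  by rewrite /g scale1r subrK.
Qed.

Definition ampl A : K -> K := xget (0 : K -> K) [set rho | is_ampliation A rho].

Lemma amplE A rho : is_ampliation A rho -> ampl A = rho.
Proof.
move=> h; apply: (ampliation_unique _ h).
by apply: (@xgetPex _ _ [set rho | is_ampliation A rho]); exists rho.
Qed.

End Ampliation.

Section Toeplitz.
Variable R : realType.
Variables (M : cstar_algebra R) (s : setting M) (X : subproduct_system s) (F : fock_space X).
Variables (D : hilbert R) (pi : M -> D -> D) (hpi : cstar_rep pi) (K : hilbert_tensor F pi).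
Variable S : forall n, X n -> K -> K.
Hypothesis hS : is_induced S.

(** Uniqueness of ampliations turns each closure property of the ampliable operators into the
    matching law of the representation; density of the ranges gives nondegeneracy. *)
Theorem induced_toeplitz_rep :
  closure (span [set z | exists n (x : X n) k, z = S x k]) = setT ->
  exists rho : (F -> F) -> K -> K, subalgebra_rep (@toeplitz _ _ _ X F) rho /\
    forall n (x : X n) k, rho (fk_shift x) k = S x k.
Proof.
move=> dS.
have sub A : toeplitz A -> exists r, is_ampliation (K := K) A r.
  move=> /(_ _ (conj (ampliable_subalgebra hpi K) _)) h.
  by case: h => // _ [n [x ->]]; split; [exact: fk_shift_adjointable | exists (S x)].
exists (ampl (K := K)); split; last by move=> n x k; rewrite (amplE (hS x)).
split.
- by move=> a /sub[r hr]; rewrite (amplE hr); case: hr.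
- move=> c a b /sub[r hr] /sub[r' hr'] h.
  by rewrite (amplE (ampliation_linear c hr hr')) (amplE hr) (amplE hr').
- move=> a b /sub[r hr] /sub[r' hr'] h.
  by rewrite (amplE (ampliation_comp hr hr')) (amplE hr) (amplE hr').
- move=> a b /sub[r hr] hab h k; have br := proj1 hr.
  by rewrite (amplE (ampliation_adjoint hab hr)) (amplE hr) hip_adjr.
- apply/seteqP; split=> // v _.
  have : closure (span [set z | exists n (x : X n) k, z = S x k]) v by rewrite dS.
  apply: closure_subset; apply: span_ind; first exact: span_subspace.
  move=> _ [n [x [k ->]]]; apply: mem_span; exists (fk_shift x), k.
  by rewrite (amplE (hS x)); split=> // A [_]; apply; exists n, x.
Qed.

End Toeplitz.

(** * Closed subspaces *)

(* Bundled, so that the instances on the type of its fixed points can be inferred. *)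
Record projector (R : realType) (H : hilbert R) := Projector {
  pr_fun :> H -> H;
  pr_bounded : bounded_op pr_fun;
  pr_idem : forall x, pr_fun (pr_fun x) = pr_fun x
}.

Section ClosedSubspace.
Variables (R : realType) (H : hilbert R) (P : projector H).
Local Notation C := R[i].

Definition fixed_pred : {pred H} := fun x => P x == x.
Definition fixed : Type := {x : H | x \in fixed_pred}.

Lemma fixed_closed : submod_closed fixed_pred.
Proof.
have lP := proj1 (pr_bounded P).
split=> [|c x y]; rewrite !unfold_in /=; first by rewrite (lin0 lP).
by move=> /eqP hx /eqP hy; rewrite lP hx hy.
Qed.

HB.instance Definition _ := GRing.isSubmodClosed.Build C H fixed_pred fixed_closed.
HB.instance Definition _ := SubChoice.on fixed.
HB.instance Definition _ := [SubChoice_isSubLmodule of fixed by <:].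

Definition fixed_norm (x : fixed) : C := `|val x|.

Lemma fixed_normD (x y : fixed) : fixed_norm (x + y) <= fixed_norm x + fixed_norm y.
Proof. by rewrite /fixed_norm raddfD ler_normD. Qed.

Lemma fixed_normZ (c : C) (x : fixed) : fixed_norm (c *: x) = `|c| * fixed_norm x.
Proof. by rewrite /fixed_norm linearZ normrZ. Qed.

Lemma fixed_norm0 (x : fixed) : fixed_norm x = 0 -> x = 0.
Proof. by move=> /eqP; rewrite normr_eq0 => /eqP h; apply: val_inj; rewrite h raddf0. Qed.

HB.instance Definition _ := Lmodule_isNormed.Build C fixed fixed_normD fixed_normZ fixed_norm0.

Lemma val_fixed (x : fixed) : P (val x) = val x.
Proof. by apply/eqP; have := valP x; rewrite unfold_in. Qed.

Lemma pr_fixed (x : H) : P x \in fixed_pred.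
Proof. by rewrite unfold_in /= pr_idem. Qed.

Definition to_fixed (x : H) : fixed := exist _ (P x) (pr_fixed x).

Lemma fixed_complete (G : set_system fixed) : ProperFilter G -> cauchy G -> cvg G.
Proof.
move=> PG cG.
have /cvg_ex[l hl] : cvg ((val : fixed -> H) @ G).
  apply: cauchy_cvg; apply: cauchy_exP => e e0.
  have /cauchyP/(_ e e0)[x hx] := cG; exists (val x).
  suff : G ((val : fixed -> H) @^-1` ball (val x) e) by [].
  by apply: filterS hx => y; rewrite -!ball_normE.
have hd : forall eps : C, 0 < eps -> \forall x \near G, `|l - val x| < eps.
  by move=> e e0; have /cvgrPdist_lt/(_ e e0) := hl.
have Pl : P l = l.
  have : closure [set x | P x = x] l.
    apply/closure_rn => e e0; have e1 : 0 < e%:C by rewrite ltcR.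
    have [x hx] := filter_ex (hd _ e1).
    by exists (val x); [exact: val_fixed | rewrite -lt_rn].
  move=> /closure_seq[u Pu ul]; apply: (tends_unique (bounded_tends (pr_bounded P) ul)).
  by apply: tends_ext ul => n; rewrite Pu.
apply/cvg_ex; exists (to_fixed l); apply/fcvgrPdist_lt => e e0.
by have := hd e e0; apply: filterS => x; rewrite -{1}Pl.
Qed.

HB.instance Definition _ := Uniform_isComplete.Build fixed fixed_complete.

Definition fixed_ip (x y : fixed) : C := hip (val x) (val y).

Lemma fixed_ip_linear (x : fixed) (c : C) (y z : fixed) :
  fixed_ip x (c *: y + z) = c * fixed_ip x y + fixed_ip x z.
Proof. by rewrite /fixed_ip linearP hip_linear. Qed.

Definition fixed_hilbert : hilbert R :=
  @Hilbert R fixed fixed_ip fixed_ip_linear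
    (fun x y => hip_conj (val x) (val y)) (fun x => hip_norm (val x)).

End ClosedSubspace.

(** * Covariant representations *)

Section Completion.
Variables (R : realType) (M : cstar_algebra R).
Local Notation C := R[i].

Lemma sub_completion (s : setting M) (F : correspondence M) (S : set F) :
  S `<=` completion s S.
Proof.
case: s => [|V] x Sx /=; first exact/subset_closure/mem_span.
move=> m f e _ e0; exists x; first exact: mem_span.
by move=> i; rewrite subrr normr0.
Qed.

(** Lets single vector functionals enter the series that define ultraweak and sigma-continuous
    functionals. *)
Lemma series_single (v : nat -> C) : (forall n, v n.+1 = 0) ->
  series v @ \oo --> (v 0%N : C^o).
Proof.
move=> v0; apply/(@tends_cvg R C^o) => e e0; exists 1%N => -[//|n] _.
by rewrite /series /= big_nat_recl // big1 ?addr0 ?subrr ?rn0.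
Qed.

Lemma vector_functional_ultraweak (H : hilbert R) (h k : H) :
  ultraweak_functional (fun A => hip h (A k)).
Proof.
have unit (g : H) : cvgn (series (fun n => `|if n is 0%N then g else 0| ^+ 2 : C^o)).
  by apply/cvg_ex; eexists; apply: series_single => n; rewrite normr0 expr0n.
exists (fun n => if n is 0%N then h else 0), (fun n => if n is 0%N then k else 0); split=> //.
move=> A bA.
have e : series (fun n => hip (if n is 0%N then h else 0)
    (A (if n is 0%N then k else 0)) : C^o) @ \oo --> (hip h (A k) : C^o).
  by apply: series_single => n; rewrite hip0l.
exact: e.
Qed.

(** Self-duality plays the part of Riesz' theorem: it represents the bounded module map x |-> <z, i
    x>. *)
Lemma self_dual_adjoint (F G : correspondence M) (i : F -> G) :
  bimodule_isometry i -> self_dual F ->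
  exists q : G -> F, forall z x, cip (q z) x = cip z (i x).
Proof.
move=> hi sd.
have /choice[q hq] z : exists y, forall x, cip y x = cip z (i x).
  have [|x a|y hy] := sd (fun x => cip z (i x)).
  - apply/bounded_rn; split=> [k x y|]; first by rewrite (bi_linear hi) cip_linear.
    exists (4 * rn z) => [|x]; first by rewrite mulr_ge0 ?rn_ge0.
    by apply: le_trans (rn_cip _ _) _; rewrite (rn_bi hi) mulrA.
  - by rewrite (bi_ract hi) cip_ract.
  - by exists y.
by exists q.
Qed.

(* Completions taken inside G are brought back to F by the adjoint of i, which
   exists in the W*-setting because F is self-dual. *)
Lemma completion_orth (s : setting M) (F G : correspondence M) (i : F -> G) (H : hilbert R)
    (f : F -> H -> H) (c : R) (S : set G) (h k : H) :
  bimodule_isometry i -> admissible s F ->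
  (if s is Wstar_setting V then sigma_continuous V f else True) ->
  (forall x, bounded_op (f x)) -> linear (fun x => f x k) ->
  (forall x, rn (f x k) <= c * rn x) ->
  (forall z, S z -> exists2 x', forall w, cip (i w) (z - i x') = 0 & hip h (f x' k) = 0) ->
  forall x, completion s S (i x) -> hip h (f x k) = 0.
Proof.
move=> hi adm cont bf lf fc hS x comp.
have li := bi_linear hi.
have sS z : span S z -> exists2 x', forall w, cip (i w) (z - i x') = 0 & hip h (f x' k) = 0.
  move: z; apply: span_ind => //; split.
    by exists 0 => [w|]; rewrite ?(lin0 li) ?subr0 ?cip0r ?(lin0 lf) ?hip0r.
  move=> a z z' [y hy ky] [y' hy' ky']; exists (a *: y + y') => [w|].
    have -> : a *: z + z' - i (a *: y + y') = a *: (z - i y) + (z' - i y').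
      by rewrite li scalerBr opprD addrACA.
    by rewrite cip_linear hy hy' scaler0 addr0.
  by rewrite lf hip_linear ky ky' mulr0 addr0.
case: s adm cont comp => [_ _|V [sd _] cont] /=.
  move=> /closure_seq[u Su ux].
  have /choice[x' hx'] n : exists x', (forall w, cip (i w) (u n - i x') = 0) /\ hip h (f x' k) = 0.
    by have [y] := sS _ (Su n); exists y.
  (* As u n - i (x' n) is orthogonal to the image of i, |x' n - x|^2 is the norm of an inner product
     with u n - i x; the 4 is that of [rn_cip]. *)
  have xx : tends x' x.
    apply: (tends_lip (c := 4)) ux _ => n.
    have [->|d0] := eqVneq (rn (x' n - x)) 0; first by rewrite mulr_ge0 ?rn_ge0.
    have dp : 0 < rn (x' n - x) by rewrite lt_def d0 rn_ge0.
    rewrite -(ler_pM2l dp) -expr2 -rn_cip_self -(bi_ip hi) [X in cip _ X](linB li).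
    have -> : i (x' n) - i x = (u n - i x) - (u n - i (x' n)).
      by rewrite opprB [RHS]addrC addrA subrK.
    rewrite cipBr (hx' n).1 subr0; apply: le_trans (rn_cip _ _) _.
    by rewrite (rn_bi hi) mulrCA.
  have fx : tends (fun n => f (x' n) k) (f x k).
    by apply: (tends_lip (c := c)) xx _ => n; rewrite -(linB lf).
  apply: (tends_unique (hip_lim h fx)).
  by apply: tends_ext (tends_cst _) => n; rewrite (hx' n).2.
have [q hq] := self_dual_adjoint hi sd.
move=> comp; apply: rn_le0; apply: eps_le0 => e e0.
have e1 : 0 < e%:C by rewrite ltcR.
have [m [g [d [hg d0 hgd]]]] := cont x _ e%:C (vector_functional_ultraweak h k) e1.
have qi y : q (i y) = y.
  by apply: cip_ext => w; rewrite cip_star hq -cip_star (bi_ip hi).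
(* Composition with q turns sigma-functionals on F into sigma-functionals on G, since <eta, q z> =
   <i eta, z>. *)
have [|z Sz hz] := comp m (fun j z => g j (q z)) d _ d0.
  move=> j; have [w [eta [b [h1 h2 h3 h4 h5]]]] := hg j.
  have E : (fun l => b l * `|i (eta l)|) = (fun l => b l * `|eta l|).
    by apply/funext => l; rewrite !rnE (rn_bi hi).
  exists w, (fun l => i (eta l)), b; split; [exact: h1 | exact: h2 | exact: h3 | |].
    by rewrite E.
  move=> z; have E' : (fun l => w l (cip (i (eta l)) z)) = (fun l => w l (cip (eta l) (q z))).
    by apply/funext => l; rewrite [in RHS]cip_star hq -cip_star.
  rewrite E'; exact: h5.
have [y hy ky] := sS _ Sz.
have qz : q z = y.
  apply: cip_ext => w; rewrite cip_star hq -cip_star -(bi_ip hi).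
  by apply/eqP; rewrite -subr_eq0 -cipBr hy.
have := hgd y; rewrite ky sub0r normrN lt_rn => H1; apply/ltW/H1 => j.
by have := hz j; rewrite qz qi.
Qed.

End Completion.

Section SubproductSystem.
Variables (R : realType) (M : cstar_algebra R) (s : setting M) (X : subproduct_system s).

(** Complementability ensures that [sp_proj] does not fall back on its default value at such
    tensors. *)
Lemma cip_sp_mul n m (x : X n) (y : X m) (w : X (n + m)%N) :
  cip (sp_incl w) (sp_tens (sp_incl x) (sp_incl y) - sp_incl (sp_mul x y)) = 0.
Proof.
rewrite /sp_mul /sp_proj.
set z := sp_tens _ _.
have ex : exists x, forall x' : X (n + m)%N, cip (sp_incl x') (z - sp_incl x) = 0.
  by apply: (@sp_complementable _ _ _ X n m z); apply: sub_completion; exists x, y.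
exact: (xgetPex (0 : X (n + m)%N) ex w).
Qed.

End SubproductSystem.

Section Covariant.
Variables (R : realType) (M : cstar_algebra R) (s : setting M) (X : subproduct_system s).
Variables (H : hilbert R) (T : covariant_rep X H).
Local Notation C := R[i].

Lemma rn_cr n (x : X n) h : rn (T n x h) <= rn x * rn h.
Proof.
(* Complete contractivity for 1 by 1 matrices, with the norm of x as the bound. *)
have := @cr_cc _ _ _ _ _ T n 1 (fun _ _ => x) `|x| (normr_ge0 x) _ (fun=> h).
rewrite !big_ord1 !rnE -!rmorphXn -rmorphM lecR /= -exprMn ler_pXn2r ?nnegrE ?mulr_ge0 ?rn_ge0 //.
apply=> b; rewrite !big_ord1 !rnE -rmorphM lecR /= rn_cip_self rn_astar_mul.
by rewrite -exprMn ler_pXn2r ?nnegrE ?mulr_ge0 ?rn_ge0 // rn_ract.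
Qed.

(** Serves as the factorization of T_(n+m) through T_n and T_m: orthogonality is checked on products
    and carried to their completion, in which X(n + m) lies. *)
Lemma cr_mul_orth n m (h k : H) :
  (forall (y : X n) (y' : X m), hip h (T _ (sp_mul y y') k) = 0) ->
  forall x : X (n + m)%N, hip h (T _ x k) = 0.
Proof.
move=> h0 x; apply: (completion_orth (@sp_incl_isometry _ _ _ X (n + m)%N)
    (sp_fibre_admissible X (n + m)%N) (cr_continuous T (n + m)%N) (c := rn k) _ _ _ _
    (sp_incl_tens x)).
- exact: cr_bounded.
- exact: cr_linear.
- by move=> y; rewrite mulrC; exact: rn_cr.
move=> _ [y [y' ->]]; exists (sp_mul y y'); last exact: h0.
by move=> w; exact: cip_sp_mul.
Qed.

End Covariant.

Section PartialIsometries.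
Variables (R : realType) (H K : hilbert R) (A : H -> K).
Hypotheses (bA : bounded_op A) (A1 : forall x, rn (A x) <= rn x).

Lemma rn_adj_le y : rn (adj A y) <= rn y.
Proof.
have [->|b0] := eqVneq (rn (adj A y)) 0; first exact: rn_ge0.
have bp : 0 < rn (adj A y) by rewrite lt_def b0 rn_ge0.
rewrite -(ler_pM2r bp) -expr2 rn_hip -hip_adjr //.
apply: le_trans (Re_le_rn _) _; apply: le_trans (cauchy_schwarz _ _) _.
by rewrite mulrC ler_wpM2l ?rn_ge0.
Qed.

(** For a contraction, |A^* A x - x|^2 <= |x|^2 - 2 |A x|^2 + |x|^2, which is 0 here. *)
Lemma adj_isometric x : rn (A x) = rn x -> adj A (A x) = x.
Proof.
move=> h; apply/eqP; rewrite -subr_eq0; apply/eqP/rn_eq0/eqP; rewrite -sqrf_eq0.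
rewrite eq_le sqr_ge0 andbT rn_sqrB hip_adjl // -rn_hip h.
have : rn (adj A (A x)) ^+ 2 <= rn x ^+ 2.
  by rewrite ler_pXn2r ?nnegrE ?rn_ge0 // -h rn_adj_le.
lra.
Qed.

Hypothesis pA : partial_isometry A.

Lemma adj_partial_isometry y : adj A (A (adj A y)) = adj A y.
Proof.
apply: adj_isometric; have [_ h] := pA.
have := h (adj A y); rewrite /rn => -> // x Ax0.
by rewrite -hip_adjr // Ax0 hip0l.
Qed.

Lemma range_projection_idem y : A (adj A (A (adj A y))) = A (adj A y).
Proof. by rewrite adj_partial_isometry. Qed.

End PartialIsometries.

(** * The defect space of a relatively isometric representation *)

Section RelativelyIsometric.
Variables (R : realType) (M : cstar_algebra R) (s : setting M) (X : subproduct_system s).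
Variables (H : hilbert R) (T : covariant_rep X H).
Variables (W : forall n : nat, hilbert_tensor (X n) (cr_sigma T)).
Variables (Tt : forall n : nat, W n -> H).
Hypotheses (hTt : is_tilde Tt) (hpure : pure Tt) (hrel : relatively_isometric Tt).
Local Notation C := R[i].
Local Notation tens n := (@ht_tens _ _ _ _ _ (W n)).
Local Notation sigma := (cr_sigma T).

Lemma sigma_rep : cstar_rep sigma.
Proof. by case: (cr_rep T). Qed.

Lemma cr_lactE n (x : X n) a h : T n (lact a x) h = sigma a (T n x h).
Proof. exact: cr_lact. Qed.

Lemma tilde_tens n (x : X n) h : Tt (tens n x h) = T n x h.
Proof. by have [_ _] := hTt n. Qed.

Lemma tilde_le n (w : W n) : rn (Tt w) <= rn w.
Proof. by have [_ h _] := hTt n; have := h w; rewrite !rnE lecR. Qed.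

Lemma tilde_bounded n : bounded_op (@Tt n).
Proof.
have [h _ _] := hTt n; apply/bounded_rn; split=> //.
by exists 1 => // w; rewrite mul1r; exact: tilde_le.
Qed.

Lemma tilde_orth n g : (forall (x : X n) h, hip (T n x h) g = 0) ->
  forall w, hip (@Tt n w) g = 0.
Proof.
move=> h w; rewrite hip_adjr; last exact: tilde_bounded.
suff -> : adj (@Tt n) g = 0 by rewrite hip0r.
apply: (dense_total (ht_dense (W n))) => _ [x [k ->]].
by rewrite -hip_adjr ?tilde_tens //; exact: tilde_bounded.
Qed.

(** As Tt n is a partial isometry, this is the projection Q_n onto its range. *)
Definition range_proj n (h : H) : H := @Tt n (adj (@Tt n) h).

Lemma range_proj_orth n v (x : X n) h : hip (T n x h) (v - range_proj n v) = 0.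
Proof.
have bT := tilde_bounded n; have [pT _] := hrel.
rewrite -tilde_tens hip_adjr // (linB (proj1 (adj_bounded bT))).
by rewrite /range_proj (adj_partial_isometry bT (@tilde_le n) (pT n)) subrr hip0r.
Qed.

Lemma range_proj_self n v k : hip (range_proj n v) k = hip v (range_proj n k).
Proof. by have bT := tilde_bounded n; rewrite /range_proj hip_adjr // hip_adjl. Qed.

Definition defect_fun (h : H) : H := h - range_proj 1 h.

Lemma defect_bounded : bounded_op defect_fun.
Proof.
have bT := tilde_bounded 1.
have := bounded_opD (-1) (bounded_op_comp bT (adj_bounded bT)) (bounded_op_id H).
congr bounded_op; apply/funext => h; by rewrite scaleN1r addrC.
Qed.

Lemma defect_idem h : defect_fun (defect_fun h) = defect_fun h.
Proof.
have bT := tilde_bounded 1; have [pT _] := hrel.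
rewrite {1}/defect_fun; set k := defect_fun h.
suff -> : range_proj 1 k = 0 by rewrite subr0.
rewrite /range_proj /k /defect_fun (linB (proj1 (adj_bounded bT))).
rewrite /range_proj (adj_partial_isometry bT (@tilde_le 1) (pT 1%N)) subrr.
exact: lin0 (proj1 bT).
Qed.

Definition defect_proj : projector H := Projector defect_bounded defect_idem.

Lemma defect_self h k : hip (defect_fun h) k = hip h (defect_fun k).
Proof. by rewrite hipBl hipBr range_proj_self. Qed.

Lemma defectE : defect Tt = defect_fun.
Proof.
exact: (psqrt_projection defect_bounded defect_self defect_idem).
Qed.

Lemma defect_orth (x : X 1%N) h d : defect_fun d = d -> hip d (T 1%N x h) = 0.
Proof. by move=> <-; apply: hip0C; exact: range_proj_orth. Qed.

Lemma orth_defect d : (forall (x : X 1%N) h, hip (T 1%N x h) d = 0) -> defect_fun d = d.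
Proof.
move=> h; rewrite /defect_fun; suff -> : range_proj 1 d = 0 by rewrite subr0.
apply: hip_eq0; rewrite range_proj_self.
have bT := tilde_bounded 1; have [pT _] := hrel.
by rewrite /range_proj (range_projection_idem bT (@tilde_le 1) (pT 1%N)) hip0C // (tilde_orth h).
Qed.

Lemma defect_sigma a d : defect_fun d = d -> defect_fun (sigma a d) = sigma a d.
Proof.
move=> hd; apply: orth_defect => x h; apply: hip0C.
by rewrite (rep_star sigma_rep) -cr_lactE; exact: defect_orth.
Qed.

(* Either form of relative isometricity says that the initial space of Tt n
   contains X(n) (x) d. *)
Lemma adj_tilde_tens n (x : X n) d : defect_fun d = d ->
  adj (@Tt n) (@Tt n (tens n x d)) = tens n x d.
Proof.
move=> hd; have bT := tilde_bounded n; have [pT [ha|hb]] := hrel.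
  have [k _ <-] : range (adj (@Tt n)) (tens n x d).
    apply: ha; apply/subset_closure/mem_span.
    by exists x, d; rewrite defectE hd.
  exact: (adj_partial_isometry bT (@tilde_le n) (pT n)).
(* The formula says that T_n(x) d has the norm of x (x) d, and a contraction that keeps the norm of
   a vector fixes it under A^* A. *)
apply: (adj_isometric bT (@tilde_le n)).
apply/eqP; rewrite -(eqrXn2 (n := 2)) ?rn_ge0 //; apply/eqP.
rewrite !rn_hip ht_ip tilde_tens; congr (complex.Re _).
have := hb n x d; rewrite !defectE hd => <-.
by rewrite -defect_self hd -hip_adjr //; exact: cr_bounded.
Qed.

Lemma cr_defect_ip n (x y : X n) d h : defect_fun d = d ->
  hip (T n x d) (T n y h) = hip d (sigma (cip x y) h).
Proof.
move=> hd; have bT := tilde_bounded n.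
by rewrite -!tilde_tens -hip_adjl // adj_tilde_tens // ht_ip.
Qed.

Lemma defect_orth_pos k (y : X k.+1) h d : defect_fun d = d -> hip d (T k.+1 y h) = 0.
Proof.
move=> hd; apply: (@cr_mul_orth _ _ _ _ _ T 1 k) => x x'.
by rewrite cr_mul; exact: defect_orth.
Qed.

(** On a product, T_n(x)^* T_n(z) acts against d as sigma(<x, z>), which the left action absorbs
    into the factor of positive degree. *)
Lemma cr_defect_orth n k (x : X n) (y : X (n + k.+1)%N) d h : defect_fun d = d ->
  hip (T n x d) (T (n + k.+1)%N y h) = 0.
Proof.
move=> hd; apply: cr_mul_orth => z z'.
by rewrite cr_mul cr_defect_ip // -cr_lactE defect_orth_pos.
Qed.

(* If Q_n v = v then Q_(n+1) v = v: for g = v - Q_(n+1) v, the vector T_n(x)^* g is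
   killed by the adjoint of Tt 1, so it lies in the defect space, to which it is also
   orthogonal; hence g is orthogonal to the range of Tt n, which contains v. *)
Lemma cr_defect_total v :
  (forall n (x : X n) d, defect_fun d = d -> hip (T n x d) v = 0) -> v = 0.
Proof.
move=> hv.
have fixv n : range_proj n v = v.
  elim: n => [|n IH]; apply/esym/eqP; rewrite -subr_eq0; apply/eqP.
    (* In degree 0 the range of Tt 0 contains that of sigma, which is total by nondegeneracy. *)
    apply: (dense_total (rep_nondegenerate sigma_rep)) => _ [a [h ->]].
    exact: range_proj_orth.
  set g := v - range_proj n.+1 v.
  have gT (x : X n.+1) h : hip (T n.+1 x h) g = 0 by exact: range_proj_orth.
  have gn (x : X n) h : hip (T n x h) g = 0.
    have bT := cr_bounded T x.
    suff -> : hip (T n x h) g = hip h (adj (T n x) g).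
      suff -> : adj (T n x) g = 0 by rewrite hip0r.
      set u := adj (T n x) g.
      have Du : defect_fun u = u.
        apply: orth_defect => y k; rewrite -hip_adjr // -cr_mul.
        by move: (sp_mul x y); rewrite addn1 => z; exact: gT.
      apply: hip_eq0; rewrite -{1}Du -hip_adjr //.
      rewrite hipBr; rewrite (hv n x _ _) ?Du // sub0r.
      suff -> : hip (T n x u) (range_proj n.+1 v) = 0 by rewrite oppr0.
      apply: hip0C; apply: tilde_orth => y k; apply: hip0C.
      by move: y; rewrite -addn1 => y; exact: cr_defect_orth.
    by rewrite hip_adjr.
  apply: hip_eq0; rewrite {1}/g hipBl /range_proj (tilde_orth gT) subr0.
  by rewrite -IH /range_proj (tilde_orth gn).
(* Purity makes the constant sequence Q_n v = v tend to 0. *)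
have := hpure v => /tends_cvg h; apply: (@tends_unique _ _ (fun=> v)); first exact: tends_cst.
by apply: tends_ext h => n; exact: fixv.
Qed.

End RelativelyIsometric.

(** * Approximation in direct sums *)

Section UltraweakNull.
Variables (R : realType) (H : hilbert R).
Local Notation C := R[i].

Lemma square_summable_tail (x : nat -> H) : cvgn (series (fun n => `|x n| ^+ 2 : C^o)) ->
  forall e : R, 0 < e -> exists N, forall m, (N <= m)%N ->
    \sum_(N <= n < m) rn (x n) ^+ 2 < e.
Proof.
move=> /cvg_ex[l /(@tends_cvg R C^o) hl] e e0.
have [N hN] := hl (e / 2) (divr_gt0 e0 (ltr0Sn R 1)).
exists N => m Nm.
have := rn_tri (series (fun n => `|x n| ^+ 2 : C^o) m) l (series (fun n => `|x n| ^+ 2 : C^o) N).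
have := hN N (leqnn N); have := hN m Nm; rewrite (rnBC l) sub_series_geq //.
have -> : \sum_(N <= k < m) `|x k| ^+ 2 = (\sum_(N <= k < m) rn (x k) ^+ 2)%:C :> C.
  by rewrite rmorph_sum; apply: eq_bigr => n _; rewrite rnE rmorphXn.
rewrite rn_real => h1 h2 h3; apply: le_lt_trans (ler_norm _) _; lra.
Qed.

(** The common bound c makes the tails of the series small uniformly in N; strong convergence
    handles the finitely many remaining terms. *)
Lemma ultraweak_null (g : (H -> H) -> C) (B : nat -> H -> H) (c : R) :
  ultraweak_functional g -> (forall N, bounded_op (B N)) ->
  (forall N h, rn (B N h) <= c * rn h) -> (forall h, tends (fun N => B N h) 0) ->
  tends (fun N => g (B N)) 0.
Proof.
move=> [x [y [sx sy hg]]] bB Bc B0 e e0.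
have c0 : 0 <= `|c| by [].
have c1 : 0 < 2 * (`|c| + 1) by rewrite mulr_gt0 // ltr_wpDl.
pose d := e / (2 * (`|c| + 1)).
have d0 : 0 < d by exact: divr_gt0.
have [n1 h1] := square_summable_tail sx d0; have [n2 h2] := square_summable_tail sy d0.
pose n0 := maxn n1 n2.
have mono (z : nat -> H) k m : (k <= n0)%N -> (n0 <= m)%N ->
    \sum_(n0 <= n < m) rn (z n) ^+ 2 <= \sum_(k <= n < m) rn (z n) ^+ 2.
  move=> kn nm; rewrite (@big_cat_nat _ _ _ n0 k m) //= lerDr.
  by apply: sumr_ge0 => i _; exact: sqr_ge0.
pose p N m := series (fun n => hip (x n) (B N (y n)) : C^o) m.
have tail N m : (n0 <= m)%N -> rn (p N m - p N n0) <= `|c| * d.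
  move=> nm; rewrite /p sub_series_geq //.
  (* Cauchy-Schwarz and a b <= (a^2 + b^2) / 2 termwise; each of the two tails of squares is below
     d. *)
  apply: (@le_trans _ _ (\sum_(n0 <= n < m) (`|c| * ((rn (x n) ^+ 2 + rn (y n) ^+ 2) / 2)))).
    elim: m nm => [|m IH]; first by rewrite leqn0 => /eqP ->; rewrite !big_geq ?rn0.
    rewrite leq_eqVlt => /orP[/eqP <-|]; first by rewrite !big_geq ?rn0.
    rewrite ltnS => nm; rewrite !big_nat_recr //=.
    apply: le_trans (rnD _ _) _; apply: lerD; first exact: IH.
    apply: le_trans (cauchy_schwarz _ _) _.
    have := Bc N (y m); have := rn_ge0 (x m); have := rn_ge0 (y m).
    have : c * rn (y m) <= `|c| * rn (y m) by rewrite ler_wpM2r ?rn_ge0 // ler_norm.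
    move: (rn (x m)) (rn (y m)) (rn (B N (y m))) => a b z h1' b0 a0 h2'.
    have : a * z <= a * (`|c| * b) by rewrite ler_wpM2l //; lra.
    have : 0 <= `|c| * (a - b) ^+ 2 by rewrite mulr_ge0 ?sqr_ge0.
    nra.
  rewrite -mulr_sumr ler_wpM2l // -mulr_suml big_split /=.
  have := mono x n1 m (leq_maxl _ _) nm; have := mono y n2 m (leq_maxr _ _) nm.
  have := h1 m (leq_trans (leq_maxl _ _) nm); have := h2 m (leq_trans (leq_maxr _ _) nm).
  lra.
have fin : tends (fun N => p N n0) (0 : C).
  rewrite /p /series /=; elim: (n0) => [|n IH].
    by apply: tends_ext (tends_cst _) => N; rewrite big_geq.
  have := tendsD IH (hip_lim (x n) (B0 (y n))); rewrite hip0r addr0.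
  by apply: tends_ext => N; rewrite big_nat_recr.
have e2 : 0 < e / 2 by rewrite divr_gt0.
have [N1 hN1] := fin _ e2; exists N1 => N /hN1; rewrite !subr0 => hp.
have : rn (g (B N) - p N n0) <= `|c| * d.
  have hgN : tends (p N) (g (B N)) by apply/(@tends_cvg R C^o); exact: hg.
  have := tendsD hgN (tends_cst (- p N n0)) => /tends_rn_le; apply.
  by exists n0 => m; exact: tail.
have : `|c| * d < e / 2.
  rewrite /d mulrA ltr_pdivrMr //.
  have -> : e / 2 * (2 * (`|c| + 1)) = `|c| * e + e by field.
  by rewrite ltrDl.
have := rn_tri (g (B N)) (p N n0) 0; rewrite !subr0; lra.
Qed.

End UltraweakNull.

(** * Convergence of truncations in self-dual direct sums *)

Section OrthogonalFamily.
Variables (R : realType) (M : cstar_algebra R) (V : von_neumann M).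
Variables (G : correspondence M) (F : nat -> correspondence M).
Variable i : forall n, F n -> G.
Hypotheses (hi : forall n, bimodule_isometry (@i n)).
Hypothesis orth : forall n m (x : F n) (y : F m), n != m -> cip (i x) (i y) = 0.
Hypotheses (sdG : self_dual G) (sdF : forall n, self_dual (F n)).
Hypothesis dense : sigma_closure V (span [set z | exists n (x : F n), z = i x]) = setT.
Local Notation C := R[i].
Local Notation rho := (@vrep R M V).
Let hrho : cstar_rep rho := vrep_rep V.

(** For a vector functional w, the map x |-> w <z, x> is itself a sigma-functional: vanishing on the
    fibres, it vanishes at z, and such w separate the points of M. *)
Lemma sigma_dense_total z : (forall n (x : F n), cip z (i x) = 0) -> z = 0.
Proof.
move=> h; apply: cip_eq0; apply: (vrep_eq (V := V)) => k; apply: hip_ext => h'.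
rewrite (rep0 hrho) hip0r; apply: rn_le0; apply: eps_le0 => e e0.
have : sigma_closure V (span [set z | exists n (x : F n), z = i x]) z by rewrite dense.
pose w (a : M) := hip h' (rho a k).
pose f x := w (cip z x).
have wn : normal_functional V w.
  by exists (fun A => hip h' (A k)); split=> //; exact: vector_functional_ultraweak.
have w0 : w 0 = 0 by rewrite /w (rep0 hrho) hip0r.
have e1 : 0 < e%:C by rewrite ltcR.
have sf : sigma_functional V f.
  exists (fun=> w), (fun n => if n is 0%N then z else 0), (fun=> (rn h' * rn k)%:C); split.
  - by [].
  - move=> _ a; rewrite !rnE -rmorphM lecR; apply: le_trans (cauchy_schwarz _ _) _.
    rewrite -mulrA ler_wpM2l ?rn_ge0 //; apply: le_trans (rep_contractive hrho _ _) _.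
    by rewrite mulrC.
  - by move=> _; rewrite ler0c mulr_ge0 ?rn_ge0.
  - apply/cvg_ex; eexists; apply: series_single => n; by rewrite normr0 mulr0.
  - move=> x.
    have c : series (fun n => w (cip (if n is 0%N then z else 0) x) : C^o) @ \oo --> (f x : C^o).
      by apply: series_single => n; rewrite cip0l.
    exact: c.
move=> /(_ 1%N (fun=> f) e%:C (fun=> sf) e1)[y Sy /(_ ord0)].
have -> : f y = 0.
  move: y Sy; apply: span_ind.
    split=> [|c x y]; first by rewrite /f /= cip0r w0.
    rewrite /f /w /= => hx hy.
    by rewrite cip_linear (rep_linear hrho) hip_linear hx hy mulr0 addr0.
  by move=> _ [n [x ->]]; rewrite /f /= h w0.
by rewrite sub0r normrN lt_rn => /ltW.
Qed.

Lemma component_adjoint : exists q : forall n, G -> F n,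
  forall n z (x : F n), cip (q n z) x = cip z (i x).
Proof.
have hq n := self_dual_adjoint (hi n) (@sdF n).
exists (fun n => projT1 (cid (hq n))) => n z x.
exact: (projT2 (cid (hq n)) z x).
Qed.

Section Truncations.
Variables (q : forall n, G -> F n) (hq : forall n z (x : F n), cip (q n z) x = cip z (i x)).

Definition component n z : G := i (q n z).

Lemma component_ip n z z' : cip (component n z) z' = cip (q n z) (q n z').
Proof. by rewrite cip_star -hq -cip_star. Qed.

Lemma component_ip2 n m z z' :
  cip (component n z) (component m z') = if n == m then cip (component n z) z' else 0.
Proof.
case: eqVneq => [->|nm]; last exact: orth.
by rewrite [RHS]component_ip /component (bi_ip (@hi m)).
Qed.

Definition truncation N z : G := \sum_(n < N) component n z.

Lemma truncation_component N m z z' :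
  cip (truncation N z) (component m z') = if (m < N)%N then cip (component m z) z' else 0.
Proof.
rewrite /truncation; elim: N => [|N IH]; first by rewrite big_ord0 cip0l.
rewrite big_ord_recr cipDl IH component_ip2 /= ltnS.
by case: (ltngtP m N) => [_|_|->]; rewrite ?addr0 ?add0r.
Qed.

Lemma truncation_ip N N' z z' : (N' <= N)%N ->
  cip (truncation N z) (truncation N' z') = cip (truncation N' z) z'.
Proof.
elim: N' => [|N' IH] le; first by rewrite /truncation !big_ord0 cip0l cip0r.
rewrite {2 3}/truncation !big_ord_recr -/(truncation N' z) -/(truncation N' z').
by rewrite cipDr cipDl IH 1?ltnW // truncation_component le.
Qed.

Lemma truncation_self N z z' : cip (truncation N z) z' = cip z (truncation N z').
Proof.
rewrite /truncation; elim: N => [|N IH]; first by rewrite !big_ord0 cip0l cip0r.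
rewrite !big_ord_recr cipDl cipDr IH; congr (_ + _).
by rewrite component_ip /component -hq.
Qed.

Lemma rn_truncation N z : rn (truncation N z) <= 4 * rn z.
Proof.
have [->|b0] := eqVneq (rn (truncation N z)) 0; first by rewrite mulr_ge0 ?rn_ge0.
have bp : 0 < rn (truncation N z) by rewrite lt_def b0 rn_ge0.
rewrite -(ler_pM2r bp) -expr2 -rn_cip_self truncation_ip // truncation_self.
by rewrite -mulrA rn_cip.
Qed.

Lemma truncation_in N n (x : F n) : (n < N)%N -> truncation N (i x) = i x.
Proof.
have qi m : component m (i x) = if m == n then i x else 0.
  case: eqVneq => [->|mn]; rewrite /component.
    by congr i; apply: cip_ext => y; rewrite cip_star hq -cip_star (bi_ip (hi n)).
  have -> : q m (i x) = 0; last exact: lin0 (bi_linear (hi m)).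
  by apply: cip_ext => y; rewrite cip0r cip_star hq orth 1?eq_sym // astar0.
elim: N => // N IH; rewrite ltnS leq_eqVlt /truncation big_ord_recr -/(truncation N (i x)) /= qi.
move=> /orP[/eqP nN|nN].
  rewrite -nN eqxx /truncation big1 ?add0r // => -[m mN] _ /=.
  by rewrite qi ltn_eqF.
by rewrite IH // gtn_eqF // addr0.
Qed.

Lemma qf_truncation_diff k z N N' : (N <= N')%N ->
  qf rho k (truncation N' z - truncation N z) =
  qf rho k (truncation N' z) - qf rho k (truncation N z).
Proof.
move=> le; rewrite /qf cipBl !cipBr (truncation_ip _ _ le).
rewrite (truncation_ip _ _ (leqnn N')) (truncation_ip _ _ (leqnn N)).
have -> : cip (truncation N z) (truncation N' z) = cip (truncation N z) z.
  by rewrite cip_star truncation_ip // -cip_star truncation_self.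
by rewrite subrr subr0 (repB hrho) hipBr raddfB.
Qed.

Lemma qf_truncation_le k z N : qf rho k (truncation N z) <= qf rho k z.
Proof.
rewrite -subr_ge0.
have -> : qf rho k z - qf rho k (truncation N z) = qf rho k (z - truncation N z).
  rewrite /qf [in RHS]cipBl !cipBr !truncation_ip // -truncation_self subrr subr0.
  by rewrite (repB hrho) hipBr raddfB.
exact: (qf_ge0 hrho).
Qed.

(** By orthogonality the form of a difference is the difference of the forms, and these increase
    with N under the bound [qf rho k z]. *)
Lemma qf_truncation_cauchy k z (e : R) : 0 < e -> exists N, forall m n, (N <= m)%N -> (N <= n)%N ->
  qf rho k (truncation m z - truncation n z) < e.
Proof.
move=> e0; pose u N := qf rho k (truncation N z).
have nd : {homo u : n m / (n <= m)%N >-> n <= m}.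
  move=> n m nm; rewrite -subr_ge0 /u -qf_truncation_diff //; exact: (qf_ge0 hrho).
have /cvg_ex[l /cvgrPdist_lt hl] : cvgn u.
  apply: nondecreasing_is_cvgn => //; exists (qf rho k z) => _ [N _ <-].
  exact: qf_truncation_le.
have e2 : 0 < e / 2 by rewrite divr_gt0.
have [N _ hN] := hl _ e2; exists N => m n Nm Nn.
wlog mn : m n Nm Nn / (n <= m)%N.
  move=> W; have [|/ltnW] := leqP n m; first exact: W.
  by move=> /(W _ _ Nn Nm); rewrite -opprB qfN.
rewrite qf_truncation_diff // -/(u m) -/(u n).
have := hN m Nm; have := hN n Nn; rewrite /= => h1 h2.
have := ler_norm (l - u n); have := ler_norm (u m - l); rewrite (distrC (u m)); lra.
Qed.

(* By self-duality the strong limit of <truncation N z, x> is <y, x> for some y, and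
   y = z because both have the same inner products with the components. *)
Lemma truncation_tends z x k :
  tends (fun N => rho (cip (truncation N z) x) k) (rho (cip z x) k).
Proof.
have strong (y x0 : G) : exists a, forall k,
    tends (fun N => rho (cip (truncation N y) x0) k) (rho a k).
  (* 16 = 4 * 4, from [rn_truncation] and [rn_cip]. *)
  apply: (@vrep_strong_limit _ _ _ _ (16 * rn y * rn x0)) => [N h|h].
    apply: le_trans (rep_contractive hrho _ _) _; rewrite ler_wpM2r ?rn_ge0 //.
    apply: le_trans (rn_cip _ _) _.
    have := rn_truncation N y; have := rn_ge0 x0; nra.
  apply: cauchy_tends => e e0.
  have y1 : 0 < rn y + 1 by rewrite ltr_wpDl ?rn_ge0.
  have d0 : 0 < (e / (rn y + 1)) ^+ 2 by rewrite exprn_gt0 // divr_gt0.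
  have [N hN] := qf_truncation_cauchy h x0 d0.
  exists N => m n Nm Nn; have := hN m n Nm Nn.
  (* The truncations are moved to x0, where they are Cauchy for [qf] at h, and [rep_cip_le] bounds
     the inner product with y. *)
  rewrite -(repB hrho) !truncation_self -cipBr => hq'.
  have := rep_cip_le hrho y (truncation m x0 - truncation n x0) h.
  have e0' := ltW e0.
  rewrite -(ltr_pXn2r (n := 2)) ?nnegrE ?rn_ge0 // => le; apply: le_lt_trans le _.
  have := rn_ge0 y; have := qf_ge0 hrho h (truncation m x0 - truncation n x0).
  move: hq'; rewrite expr_div_n ltr_pdivlMr ?exprn_gt0 //.
  move: (qf _ _ _) => w; have := sqr_ge0 (rn y); nra.
have /choice[al hal] : forall x0, exists a, forall k,
    tends (fun N => rho (cip (truncation N z) x0) k) (rho a k).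
  exact: strong.
have lal : linear al.
  move=> a u v; apply: (vrep_eq (V := V)) => h.
  rewrite (rep_linear hrho); apply: (tends_unique (hal _ h)).
  have := tendsD (tendsZ a (hal u h)) (hal v h); apply: tends_ext => N.
  by rewrite cip_linear (rep_linear hrho).
have bal : bounded_op al.
  apply/bounded_rn; split=> //; exists (16 * rn z) => [|u]; first by rewrite mulr_ge0 ?rn_ge0.
  (* Only represented elements are known to converge; this converts their bound into the norm bound
     that self-duality requires. *)
  apply: (vrep_norm_le (V := V)) => [|h]; first by rewrite !mulr_ge0 ?rn_ge0.
  apply: (tends_rn_le (hal u h)); exists 0%N => N _.
  apply: le_trans (rep_contractive hrho _ _) _; rewrite ler_wpM2r ?rn_ge0 //.
  apply: le_trans (rn_cip _ _) _.
  have := rn_truncation N z; have := rn_ge0 u; nra.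
have mal u a : al (ract u a) = amul (al u) a.
  apply: (vrep_eq (V := V)) => h; rewrite (rep_mul hrho); apply: (tends_unique (hal _ h)).
  by apply: tends_ext (hal u (rho a h)) => N; rewrite cip_ract (rep_mul hrho).
have [y hy] := sdG bal mal.
have yz : y = z.
  apply/eqP; rewrite -subr_eq0; apply/eqP; apply: sigma_dense_total => n v.
  rewrite cipBl -hy; apply/eqP; rewrite subr_eq0; apply/eqP.
  apply: (vrep_eq (V := V)) => h; apply: (tends_unique (hal _ h)).
  move=> e e0; exists n.+1 => N nN.
  by rewrite truncation_self truncation_in // subrr rn0.
by have := hal x k; rewrite hy yz.
Qed.

Lemma truncation_normal (w : M -> C) z : normal_functional V w ->
  tends (fun N => w (cip (z - truncation N z) (z - truncation N z))) 0.
Proof.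
move=> [g [ug hw]].
have : tends (fun N => g (rho (cip (z - truncation N z) (z - truncation N z)))) 0.
  (* 5 = 1 + 4 bounds z minus a truncation, by [rn_truncation]. *)
  apply: (ultraweak_null (c := (5 * rn z) ^+ 2) ug) => [N|N h|h].
  - exact: rep_bounded hrho _.
  - apply: le_trans (rep_contractive hrho _ _) _; rewrite ler_wpM2r ?rn_ge0 //.
    rewrite rn_cip_self ler_pXn2r ?nnegrE ?mulr_ge0 ?rn_ge0 //.
    by have := rnB z (truncation N z); have := rn_truncation N z; lra.
  have E N : cip (z - truncation N z) (z - truncation N z) = cip z z - cip (truncation N z) z.
    by rewrite cipBl !cipBr !truncation_ip // -truncation_self subrr subr0.
  have := tendsD (tends_cst (rho (cip z z) h)) (tendsZ (-1) (truncation_tends z z h)).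
  rewrite scaleN1r subrr; apply: tends_ext => N.
  by rewrite E (repB hrho) scaleN1r.
by apply: tends_ext => N; rewrite hw.
Qed.

End Truncations.

Lemma sigma_approx (D : hilbert R) (pi : M -> D -> D) (d : D) z (e : R) :
  cstar_rep pi -> normal_functional V (fun a => hip d (pi a d)) -> 0 < e ->
  exists2 y, span [set z | exists n (x : F n), z = i x] y & qf pi d (z - y) < e.
Proof.
move=> hpi nf e0; have [q hq] := component_adjoint.
have [N hN] := truncation_normal hq z nf e0.
exists (truncation q N z).
  rewrite /truncation; elim: (N) => [|m IH].
    by rewrite big_ord0; case: (span_subspace [set z | exists n (x : F n), z = i x]).
  rewrite big_ord_recr; apply: subspaceD => //; first exact: span_subspace.
  by apply: mem_span; exists m, (q m z).
by have := hN N (leqnn N); rewrite subr0; apply: le_lt_trans; exact: Re_le_rn.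
Qed.

End OrthogonalFamily.

Section FockApproximation.
Variables (R : realType) (M : cstar_algebra R).

(** Both kinds of density give density in the seminorm at a fixed d, so the tensor map on the Fock
    space can be built for the two settings at once. *)
Lemma completion_approx (s : setting M) (G : correspondence M) (F : nat -> correspondence M)
    (i : forall n, F n -> G) (D : hilbert R) (pi : M -> D -> D) (d : D) z (e : R) :
  (forall n, bimodule_isometry (@i n)) ->
  (forall n m (x : F n) (y : F m), n != m -> cip (i n x) (i m y) = 0) ->
  admissible s G -> (forall n, admissible s (F n)) ->
  completion s [set z | exists n (x : F n), z = i n x] = setT ->
  representation s pi -> 0 < e ->
  exists2 y, span [set z | exists n (x : F n), z = i n x] y & qf pi d (z - y) < e.
Proof.
move=> hi orth; case: s => [_ _|V [sdG _] adF] /= dns [hpi nf] e0.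
  have : closure (span [set z | exists n (x : F n), z = i n x]) z by rewrite dns.
  have d0 : 0 < rn d ^+ 2 + 1 by rewrite ltr_wpDl ?sqr_ge0.
  have c0 : 0 < Num.min 1 (e / (rn d ^+ 2 + 1)) by rewrite lt_min ltr01 divr_gt0.
  move=> /closure_rn/(_ _ c0)[y Sy]; rewrite lt_min ltr_pdivlMr // => /andP[h1 h2].
  exists y => //; apply: le_lt_trans (qf_le hpi d (z - y)) _.
  have := rn_ge0 (z - y); have := sqr_ge0 (rn d); nra.
have sdF n : self_dual (F n) by case: (adF n).
exact: (sigma_approx hi orth sdG sdF dns z hpi (nf d d) e0).
Qed.

End FockApproximation.

(** * The induced model *)

Section InducedModel.
Variables (R : realType) (M : cstar_algebra R) (s : setting M) (X : subproduct_system s).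
Variables (H : hilbert R) (T : covariant_rep X H).
Variables (W : forall n : nat, hilbert_tensor (X n) (cr_sigma T)).
Variables (Tt : forall n : nat, W n -> H) (F : fock_space X).
Hypotheses (hTt : is_tilde Tt) (hpure : pure Tt) (hrel : relatively_isometric Tt).
Local Notation C := R[i].
Local Notation sigma := (cr_sigma T).
Local Notation P := (defect_proj hTt hrel).
Local Notation D := (fixed_hilbert P).
Local Notation v := (fun d : D => val (d : fixed P)).

Let hsig : cstar_rep sigma := sigma_rep T.

Lemma val_defect (d : D) : defect_fun Tt (v d) = v d.
Proof. exact: (val_fixed (P := P) d). Qed.

(** The projection only supplies membership in D, which sigma already preserves. *)
Definition defect_rep (a : M) (d : D) : D := to_fixed P (sigma a (v d)).

Lemma val_defect_rep a d : v (defect_rep a d) = sigma a (v d).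
Proof. exact: (defect_sigma hTt hrel a (val_defect d)). Qed.

Lemma val_linear c (d e : D) : v (c *: d + e) = c *: v d + v e.
Proof. exact: (linearP (val : fixed P -> H)). Qed.

Lemma defect_representation : representation s defect_rep.
Proof.
split.
  split.
  - move=> a; apply/bounded_rn; split=> [c x y|].
      apply: val_inj; rewrite [RHS]val_linear !val_defect_rep val_linear.
      exact: (lin_repr hsig).
    exists (rn a) => [|d]; first exact: rn_ge0.
    have := rep_contractive hsig a (v d); rewrite -val_defect_rep; exact.
  - move=> c a b d; apply: val_inj; rewrite [RHS]val_linear !val_defect_rep.
    exact: (rep_linear hsig).
  - move=> a b d; apply: val_inj; rewrite !val_defect_rep.
    exact: (rep_mul hsig).
  - move=> a d e; rewrite /= /fixed_ip !val_defect_rep.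
    exact: (rep_star hsig).
  - apply: total_dense => d hd; apply: val_inj; rewrite linear0.
    (* As D reduces sigma, (sigma a k, d) = (sigma a (P k), d) for every k in H, so nondegeneracy
       passes to D. *)
    apply: (dense_total (rep_nondegenerate hsig)) => _ [a [k ->]].
    rewrite (rep_star hsig) -val_defect_rep -val_defect -(defect_self hTt).
    have -> : defect_fun Tt k = v (to_fixed P k) by [].
    rewrite val_defect_rep -(rep_star hsig) -val_defect_rep.
    by apply: hd; exists a, (to_fixed P k).
(* The setting is generalized because X and T depend on s, which blocks a case analysis on s
   itself. *)
suff gen (s' : setting M) : normal_rep s' sigma -> normal_rep s' defect_rep.
  exact: gen (proj2 (cr_rep T)).
case: s' => // V h d e.
have := h (v d) (v e); congr normal_functional; apply/funext => a.
by rewrite /= /fixed_ip val_defect_rep.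
Qed.

Implicit Types (f g : F) (d e : D).

Lemma cr_fock_ip n m (x : X n) (y : X m) d e :
  hip (T n x (v d)) (T m y (v e)) =
  hip (v d) (sigma (cip (fk_in F x) (fk_in F y)) (v e)).
Proof.
have [nm|nm] := eqVneq n m.
  by subst m; rewrite (cr_defect_ip hTt hrel) ?val_defect // (bi_ip (fk_in_isometry F n)).
rewrite (fk_in_orthogonal F _ _ nm) (rep0 hsig) hip0r.
have lt n' m' (x' : X n') (y' : X m') d' e' : (n' < m')%N ->
    hip (T n' x' (v d')) (T m' y' (v e')) = 0.
  move=> lt; move: y'; rewrite -(subnKC lt) addSnnS => y'.
  by apply: (cr_defect_orth hTt hrel); exact: val_defect.
by case: (ltngtP n m) nm => // lnm _; [exact: lt | apply: hip0C; exact: lt].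
Qed.

(** The same formal sum is evaluated in F and, by [usum], in H; [usum_dist] compares the values. *)
Definition fsum (l : seq (C * {n : nat & X n})) : F :=
  \sum_(p <- l) p.1 *: fk_in F (tagged p.2).

Definition usum (l : seq (C * {n : nat & X n})) (d : D) : H :=
  \sum_(p <- l) p.1 *: T (tag p.2) (tagged p.2) (v d).

Lemma usum_ip l l' d e :
  hip (usum l d) (usum l' e) = hip (v d) (sigma (cip (fsum l) (fsum l')) (v e)).
Proof.
have one n (x : X n) : hip (T n x (v d)) (usum l' e) =
    hip (v d) (sigma (cip (fk_in F x) (fsum l')) (v e)).
  rewrite /usum /fsum; elim: l' => [|[c [m y]] l' IH].
    by rewrite !big_nil cip0r (rep0 hsig) !hip0r.
  rewrite !big_cons hipDr hipZr IH /= cr_fock_ip cipDr cipZr.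
  by rewrite (rep_linear hsig) hip_linear.
elim: l => [|[c [n x]] l IH].
  by rewrite /usum /fsum !big_nil cip0l (rep0 hsig) hip0l hip0r.
rewrite {1}/usum {1}/fsum !big_cons hipDl hipZl -/(usum l d) -/(fsum l) IH one /=.
by rewrite cipDl cipZl (rep_linear hsig) hip_linear.
Qed.

Lemma usum_dist l l' d : rn (usum l d - usum l' d) ^+ 2 = qf sigma (v d) (fsum l - fsum l').
Proof.
rewrite rn_hip hipBl !hipBr !usum_ip /qf cipBl !cipBr !(repB hsig) !hipBr.
by [].
Qed.

Lemma span_fsum f : span [set z | exists n (x : X n), z = fk_in F x] f -> exists l, f = fsum l.
Proof.
move: f; apply: span_ind.
  split; first by exists [::]; rewrite /fsum big_nil.
  move=> c _ _ [l ->] [l' ->]; exists ([seq (c * p.1, p.2) | p <- l] ++ l').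
  rewrite /fsum big_cat big_map scaler_sumr; congr (_ + _).
  by apply: eq_bigr => p _; rewrite scalerA.
move=> _ [n [x ->]]; exists [:: (1, existT (fun n => ccar (X n)) n x)].
by rewrite /fsum big_seq1 scale1r.
Qed.

(** The graph of f |-> f (x) d: one formal sum must approach f in the seminorm of d and w in norm,
    so the sum may depend on d. *)
Definition approximates f d (w : H) : Prop := forall r : R, 0 < r ->
  exists l, qf sigma (v d) (f - fsum l) < r ^+ 2 /\ rn (w - usum l d) < r.

Lemma approximates_exists f d : exists w, approximates f d w.
Proof.
have [dl dl0 dlN] := null_seq R.
have /choice[l hl] n : exists l, qf sigma (v d) (f - fsum l) < dl n ^+ 2.
  have [|y Sy hy] := completion_approx (v d) f (fk_in_isometry F)
    (@fk_in_orthogonal _ _ _ _ F) (fk_admissible F) (sp_fibre_admissible X) (fk_dense F) (cr_rep T)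
    (_ : 0 < dl n ^+ 2); first by rewrite exprn_gt0.
  by have [l e] := span_fsum Sy; exists l; rewrite -e.
(* The parallelogram law stands in for the triangle inequality of the seminorm. *)
have close m n : rn (usum (l m) d - usum (l n) d) ^+ 2 <= 2 * dl m ^+ 2 + 2 * dl n ^+ 2.
  rewrite usum_dist.
  have -> : fsum (l m) - fsum (l n) = (f - fsum (l n)) - (f - fsum (l m)).
    by rewrite opprB [RHS]addrC addrA subrK.
  have := qf_ge0 hsig (v d) ((f - fsum (l n)) + (f - fsum (l m))).
  have := qf_par hsig (v d) (f - fsum (l n)) (f - fsum (l m)).
  have := hl m; have := hl n; lra.
have [w hw] : exists w, tends (fun n => usum (l n) d) w.
  apply: cauchy_tends => e e0.
  have [N hN] := dlN _ (divr_gt0 e0 (ltr0Sn R 1)).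
  exists N => m n /hN hm /hN hn; have e0' := ltW e0.
  rewrite -(ltr_pXn2r (n := 2)) ?nnegrE ?rn_ge0 //; apply: le_lt_trans (close m n) _.
  have := dl0 m; have := dl0 n; nra.
exists w => r r0; have [N hN] := dlN _ r0; have [N' hN'] := hw _ r0.
exists (l (maxn N N')); split; last by rewrite rnBC; apply: hN'; exact: leq_maxr.
apply: lt_trans (hl _) _; have r0' := ltW r0; have dl' := ltW (dl0 (maxn N N')).
by rewrite ltr_pXn2r ?nnegrE // hN // leq_maxl.
Qed.

Lemma approximates_usum_ip f d w l e : approximates f d w ->
  hip w (usum l e) = hip (v d) (sigma (cip f (fsum l)) (v e)).
Proof.
move=> h; apply/eqP; rewrite -subr_eq0; apply/eqP/rn_le0.
apply: (@eps_le0M _ _ (rn (usum l e) + rn (v e) * rn (fsum l))) => r r0.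
have [l' [h1 h2]] := h r r0.
have -> : hip w (usum l e) - hip (v d) (sigma (cip f (fsum l)) (v e)) =
    hip (w - usum l' d) (usum l e) - hip (v d) (sigma (cip (f - fsum l') (fsum l)) (v e)).
  by rewrite hipBl usum_ip cipBl (repB hsig) hipBr opprB addrA subrK.
apply: le_trans (rnB _ _) _; rewrite mulrDl; apply: lerD.
  apply: le_trans (cauchy_schwarz _ _) _.
  by rewrite mulrC ler_wpM2l ?rn_ge0 // ltW.
rewrite hip_conj rn_conj (rep_star hsig) -cip_star.
have r0' := ltW r0.
rewrite -(ler_pXn2r (n := 2)) ?nnegrE ?mulr_ge0 ?rn_ge0 //.
apply: le_trans (hip_rep_cip_le hsig _ _ _ _) _.
by rewrite !exprMn ler_wpM2l ?mulr_ge0 ?rn_ge0 // ltW.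
Qed.

(** The two arguments are approximated one at a time: [approximates] gives no control over the norms
    of the approximating [fsum], so they must stay out of the constant. *)
Lemma approximates_ip f d w g e w' : approximates f d w -> approximates g e w' ->
  hip w w' = hip (v d) (sigma (cip f g) (v e)).
Proof.
move=> h h'; apply/eqP; rewrite -subr_eq0; apply/eqP/rn_le0.
apply: (@eps_le0M _ _ (rn w + rn (v d) * rn f)) => r r0.
have [l [h1 h2]] := h' r r0.
have -> : hip w w' - hip (v d) (sigma (cip f g) (v e)) =
    hip w (w' - usum l e) - hip (v d) (sigma (cip f (g - fsum l)) (v e)).
  by rewrite hipBr (approximates_usum_ip _ _ h) cipBr (repB hsig) hipBr opprB addrA subrK.
apply: le_trans (rnB _ _) _; rewrite mulrDl; apply: lerD.
  apply: le_trans (cauchy_schwarz _ _) _.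
  by rewrite ler_wpM2l ?rn_ge0 // ltW.
have r0' := ltW r0.
rewrite -(ler_pXn2r (n := 2)) ?nnegrE ?mulr_ge0 ?rn_ge0 //.
apply: le_trans (hip_rep_cip_le hsig _ _ _ _) _.
by rewrite !exprMn ler_wpM2l ?mulr_ge0 ?rn_ge0 // ltW.
Qed.

Definition fock_tens f d : H := projT1 (cid (approximates_exists f d)).

Lemma fock_tensP f d : approximates f d (fock_tens f d).
Proof. exact: (projT2 (cid (approximates_exists f d))). Qed.

Lemma fock_tens_ip f d g e :
  hip (fock_tens f d) (fock_tens g e) = hip (v d) (sigma (cip f g) (v e)).
Proof. by apply: approximates_ip; exact: fock_tensP. Qed.

Lemma fock_tens_in n (x : X n) d : fock_tens (fk_in F x) d = T n x (v d).
Proof.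
have a : approximates (fk_in F x) d (T n x (v d)).
  move=> r r0; exists [:: (1, existT (fun n => ccar (X n)) n x)].
  rewrite /fsum /usum !big_seq1 !scale1r /= !subrr rn0 /qf cip0r (rep0 hsig) hip0r.
  by rewrite exprn_gt0.
have b := fock_tensP (fk_in F x) d.
apply/eqP; rewrite -subr_eq0; apply/eqP/hip_eq0.
rewrite hipBl !hipBr (approximates_ip b b) (approximates_ip b a).
by rewrite (approximates_ip a b) (approximates_ip a a) subrr.
Qed.

(** Purity enters here. Vectors of H are then determined by scalar inner products, which yields the
    linearity of the arbitrarily chosen [fock_tens]. *)
Lemma fock_total (w w' : H) :
  (forall n (x : X n) d, hip (fock_tens (fk_in F x) d) w = hip (fock_tens (fk_in F x) d) w') ->
  w = w'.
Proof.
move=> h; apply/eqP; rewrite -subr_eq0; apply/eqP.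
apply: (cr_defect_total hTt hpure hrel) => n x d hd.
have -> : d = v (to_fixed P d) by rewrite /= hd.
by rewrite -fock_tens_in hipBr h subrr.
Qed.

Lemma fock_tens_linearl d : linear (fun f => fock_tens f d).
Proof.
move=> c f g; apply: fock_total => n x e.
by rewrite hip_linear !fock_tens_ip cip_linear (rep_linear hsig) hip_linear.
Qed.

Lemma fock_tens_linearr f : linear (fock_tens f).
Proof.
move=> c d e; apply: fock_total => n x d'.
rewrite hip_linear !fock_tens_ip val_linear (lin_repr hsig) hip_linear.
by [].
Qed.

Lemma fock_tens_dense : closure (span [set z | exists f d, z = fock_tens f d]) = setT.
Proof.
apply: total_dense => w hw; apply: fock_total => n x d.
by rewrite hip0r; apply: hw; exists (fk_in F x), d.
Qed.

Lemma fock_tens_ip_rep f d g e :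
  hip (fock_tens f d) (fock_tens g e) = hip d (defect_rep (cip f g) e).
Proof. by rewrite fock_tens_ip /= /fixed_ip val_defect_rep. Qed.

(* H itself, with f (x) d sent to the limit of the T(y) d for y in the span of the
   fibres approaching f, is a model of F (x) D. *)
Definition fock_model : hilbert_tensor F defect_rep :=
  @HilbertTensor R M F D defect_rep H fock_tens fock_tens_linearl fock_tens_linearr
    fock_tens_ip_rep fock_tens_dense.

(** Both operators are moved to the other side of an inner product, where their adjoints act on
    fibre vectors; so no limit in f is taken, in either setting. *)
Lemma fock_shift_tens n (x : X n) f d :
  T n x (fock_tens f d) = fock_tens (fk_shift x f) d.
Proof.
have [B hB] := fk_shift_adjointable F x.
have bT := cr_bounded T x.
have adjT m (y : X m) e : adj (T n x) (T m y (v e)) = fock_tens (B (fk_in F y)) e.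
  apply: fock_total => k u d'; rewrite fock_tens_ip -hB fk_shiftE fock_tens_in.
  by rewrite -hip_adjr // -cr_mul cr_fock_ip.
apply: fock_total => m y e.
rewrite [in LHS]fock_tens_in -hip_adjl // adjT !fock_tens_ip.
by rewrite (cip_star _ (fk_in F y)) hB -cip_star.
Qed.

Lemma fock_model_induced : is_induced (K := fock_model) (fun n x => T n x).
Proof.
move=> n x; split=> [|f d]; first exact: cr_bounded.
exact: fock_shift_tens.
Qed.

Lemma cr_range_dense : closure (span [set z | exists n (x : X n) k, z = T n x k]) = setT.
Proof.
apply/seteqP; split=> // w _.
have : closure (span [set z | exists a h, z = sigma a h]) w.
  by rewrite (rep_nondegenerate hsig).
apply: closure_subset; apply: span_ind; first exact: span_subspace.
by move=> _ [a [k ->]]; apply: mem_span; exists 0%N, a, k.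
Qed.

End InducedModel.

Theorem theorem3p8 (R : realType) (M : cstar_algebra R) (s : setting M)
    (X : subproduct_system s) (H : hilbert R) (T : covariant_rep X H)
    (W : forall n : nat, hilbert_tensor (X n) (cr_sigma T))
    (Tt : forall n : nat, W n -> H) (F : fock_space X) :
  is_tilde Tt -> pure Tt -> relatively_isometric Tt ->
  unitarily_equivalent_to_induced F T /\ extends_to_cstar_rep F T.
Proof.
move=> hTt hpure hrel.
pose K := fock_model F hTt hpure hrel.
have hS : is_induced (K := K) (fun n x => T n x) := fock_model_induced F hTt hpure hrel.
have hpi := defect_representation hTt hrel.
split.
  exists (fixed_hilbert (defect_proj hTt hrel)), (defect_rep (hrel := hrel)), K.
  (* The model has H as its space and T as its induced family, so the unitary is the identity. *)
  exists (fun n x => T n x), id.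
  split; [exact: hpi | exact: hS | | by []].
  by split=> // k; exists k.
have [rho [h1 h2]] := induced_toeplitz_rep (proj1 hpi) hS (cr_range_dense T).
by exists rho.
Qed.
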